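(* Let $k,n,m\ge1$ be integers, let $z_1,\dots,z_n$ be distinct nonzero points of the open unit disk $\mathbb D$, let $W_1,\dots,W_n\in\mathbb C^{k\times k}$, and let $B$ be the finite Blaschke product $$B(z)=\prod_{i=1}^m\left(\frac{z-\lambda_i}{1-\overline{\lambda_i}z}\right)^{r_i},$$ where $\lambda_1,\dots,\lambda_m\in\mathbb D$ are distinct and $r_1,\dots,r_m\ge 1$ are integers. Assume that $z_i\ne\lambda_j$ for $i=1,\dots,n$ and $j=1,\dots,m$. Then there exists a function $S\in(\mathcal S_B)^{k\times k}$ satisfying $S(z_i)=W_i$ for $i=1,\dots,n$ if and only if there exists a $k\times k$ complex matrix $X$ such that the matrix $$\mathbb P_X=\begin{bmatrix}\mathbb P&(I-\widetilde WX_n^* )\widetilde{\mathbb Q}^*&0\\ \widetilde{\mathbb Q}(I-X_n\widetilde W^* )&\mathbb Q&X_d\\ 0&X_d^*&\mathbb Q^{-1}\end{bmatrix}\in\mathbb C^{k(n+2d)\times k(n+2d)}$$ is positive semidefinite.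
   Context: $H^\infty$ is the algebra of bounded holomorphic functions on $\mathbb D$. $(\mathcal S_B)^{k\times k}$ is the set of $k\times k$ matrix functions $S$ whose entries all lie in $\mathbb C+BH^\infty$ and with $\|S\|_\infty=\sup_{z\in\mathbb D}\|S(z)\|\le1$ (operator norm). Put $d=r_1+\cdots+r_m$. For $X\in\mathbb C^{k\times k}$ and an integer $j\ge 1$, $X_j\in\mathbb C^{jk\times jk}$ is the block diagonal matrix with $j$ diagonal blocks all equal to $X$. Let $$\mathbb P=\left[\frac{I_k-W_iW_j^*}{1-z_i\overline{z_j}}\right]_{i,j=1}^n,\quad Z=\operatorname{diag}(z_1I_k,\dots,z_nI_k),\quad E=\begin{bmatrix}I_k\\ \vdots\\ I_k\end{bmatrix}\in\mathbb C^{kn\times k},\quad \widetilde W=\operatorname{diag}(W_1,\dots,W_n)\in\mathbb C^{kn\times kn}.$$ Let $J=\operatorname{diag}(J_1,\dots,J_m)\in\mathbb C^{kd\times kd}$ and $\widetilde E=\begin{bmatrix}\widetilde E_1\\ \vdots\\ \widetilde E_m\end{bmatrix}\in\mathbb C^{kd\times k}$, where, for each $i$, $J_i\in\mathbb C^{kr_i\times kr_i}$ is the $r_i\times r_i$ block matrix with $\lambda_iI_k$ on the block diagonal, $I_k$ on the first block subdiagonal and zeros elsewhere, and $\widetilde E_i\in\mathbb C^{kr_i\times k}$ is the block column with first block $I_k$ and all other blocks $0$. Finally $\mathbb Q\in\mathbb C^{kd\times kd}$ and $\widetilde{\mathbb Q}\in\mathbb C^{kd\times kn}$ are the unique solutions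 of the Stein equations $$\mathbb Q-J\mathbb QJ^*=\widetilde E\widetilde E^*,\qquad \widetilde{\mathbb Q}-J\widetilde{\mathbb Q}Z^*=\widetilde EE^*,$$ that is, $\mathbb Q=\sum_{i\ge0}J^i\widetilde E\widetilde E^*J^{*i}$ and $\widetilde{\mathbb Q}=\sum_{i\ge0}J^i\widetilde EE^*Z^{*i}$. The matrix $\mathbb Q$ is positive definite, hence invertible. *)

(* Defs.v *)
From HB Require Import structures.
From mathcomp Require Import all_boot all_order all_algebra.
From mathcomp Require Import spectral complex.
From mathcomp Require Import all_classical all_reals all_analysis.
Set Implicit Arguments.
Unset Strict Implicit.
Unset Printing Implicit Defensive.
Import Order.TTheory GRing.Theory Num.Theory.
Import numFieldNormedType.Exports.
Local Open Scope classical_set_scope.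
Local Open Scope ring_scope.
Local Open Scope sesquilinear_scope.

Definition disk (R : realType) : set R[i] := [set z | `|z| < 1].

(* [R[i]^o] is [R[i]] as a normed space over itself, so that [derivable h z 1]
   is complex differentiability of [h] at [z]. *)
Definition holomorphic_on_disk (R : realType) (h : R[i] -> R[i]) : Prop :=
  forall z, disk z -> derivable (h : R[i]^o -> R[i]^o) z 1.

(* Functions on the disk are represented by total functions on [R[i]]: every
   condition below only involves their values on [disk]. *)
Definition Hinfty (R : realType) : set (R[i] -> R[i]) :=
  [set h | holomorphic_on_disk h /\
           exists M : R, forall z, disk z -> Normc.normc (h z) <= M].

Definition blaschke (R : realType) (m : nat) (lambda : 'I_m -> R[i])
    (r : 'I_m -> nat) (z : R[i]) : R[i] :=
  \prod_(i < m) ((z - lambda i) / (1 - (lambda i)^* * z)) ^+ r i.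

Definition CBHinfty (R : realType) (B : R[i] -> R[i]) : set (R[i] -> R[i]) :=
  [set f | exists c : R[i], exists2 h, Hinfty h &
           forall z, disk z -> f z = c + B z * h z].

Definition vnorm (R : realType) (k : nat) (v : 'cV[R[i]]_k) : R :=
  Num.sqrt (\sum_(i < k) Normc.normc (v i 0) ^+ 2).

Definition opnorm (R : realType) (k : nat) (A : 'M[R[i]]_k) : \bar R :=
  ereal_sup [set (vnorm (A *m v))%:E | v in [set v | vnorm v <= 1]].

Definition supnorm (R : realType) (k : nat) (S : R[i] -> 'M[R[i]]_k) : \bar R :=
  ereal_sup [set opnorm (S z) | z in @disk R].

Definition schurB (R : realType) (k : nat) (B : R[i] -> R[i]) :
    set (R[i] -> 'M[R[i]]_k) :=
  [set S : R[i] -> 'M[R[i]]_k | (forall a b : 'I_k, CBHinfty B (fun z => S z a b)) /\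
           (supnorm S <= 1%:E)%E].

(* In the partial order of [R[i]], [0 <= x] says that [x] is real and
   nonnegative; hence the second condition already entails the first. *)
Definition psd (R : realType) (N : nat) (A : 'M[R[i]]_N) : Prop :=
  A ^t* = A /\ forall v : 'cV[R[i]]_N, 0 <= (v ^t* *m A *m v) 0 0.

(* The solution [X] of [X - A X B = C], when there is exactly one. *)
Definition stein (R : realType) (p q : nat) (A : 'M[R[i]]_p) (B : 'M[R[i]]_q)
    (C : 'M[R[i]]_(p, q)) : 'M[R[i]]_(p, q) :=
  xget 0 [set X | X - A *m X *m B = C].

Section Data.
Variables (R : realType) (k n m : nat).
Variables (z : 'I_n -> R[i]) (W : 'I_n -> 'M[R[i]]_k).
Variables (lambda : 'I_m -> R[i]) (r : 'I_m -> nat) (X : 'M[R[i]]_k).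

(* The dimensions kn and kd are written as sums of block sizes, as required by
   [mxblock] and its variants. *)
Definition dimn : nat := \sum_(i < n) k.
Definition dimd : nat := \sum_(i < m) \sum_(a < r i) k.

Definition pickP : 'M[R[i]]_dimn :=
  \mxblock_(i < n, j < n)
    ((1 - z i * (z j)^*)^-1 *: (1%:M - W i *m (W j) ^t*)).

Definition Zmx : 'M[R[i]]_dimn := \mxdiag_(i < n) (z i)%:M.

Definition Emx : 'M[R[i]]_(dimn, k) := \mxcol_(i < n) 1%:M.

Definition Wtmx : 'M[R[i]]_dimn := \mxdiag_(i < n) W i.

Definition Jblock (i : 'I_m) : 'M[R[i]]_(\sum_(a < r i) k) :=
  \mxblock_(a < r i, b < r i)
    (if a == b then (lambda i)%:M
     else if (a == b.+1 :> nat) then 1%:M else 0 : 'M[R[i]]_k).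

Definition Jmx : 'M[R[i]]_dimd := \mxdiag_(i < m) Jblock i.

Definition Etblock (i : 'I_m) : 'M[R[i]]_(\sum_(a < r i) k, k) :=
  \mxcol_(a < r i) (if (a == 0%N :> nat) then 1%:M else 0 : 'M[R[i]]_k).

Definition Etmx : 'M[R[i]]_(dimd, k) := \mxcol_(i < m) Etblock i.

Definition Qmx : 'M[R[i]]_dimd := stein Jmx (Jmx ^t*) (Etmx *m Etmx ^t*).

Definition Qtmx : 'M[R[i]]_(dimd, dimn) :=
  stein Jmx (Zmx ^t*) (Etmx *m Emx ^t*).

Definition Xn : 'M[R[i]]_dimn := \mxdiag_(i < n) X.

(* The [d] diagonal copies of [X], grouped as the blocks of [Jmx]. *)
Definition Xd : 'M[R[i]]_dimd := \mxdiag_(i < m) \mxdiag_(a < r i) X.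

Definition PX : 'M[R[i]]_(dimn + dimd + dimd) :=
  block_mx
    (block_mx pickP                                 ((1%:M - Wtmx *m Xn ^t*) *m Qtmx ^t*)
              (Qtmx *m (1%:M - Xn *m Wtmx ^t*))     Qmx)
    (col_mx 0 Xd)
    (row_mx 0 (Xd ^t*))
    (invmx Qmx).

End Data.

(* Main.v *)
(** [S] lies in [C + B H^oo] entrywise exactly when, for some matrix [X], [S - X] is
    [B] times a bounded analytic function, i.e. when [S] takes the value [X] at each
    [lambda j] with vanishing derivatives up to order [r j - 1].  With
    [A = diag(Z, J)], [E = (E, Et)] and [F = (W E, Et X)] all the conditions read
    [E S(z) - F = (z - A) K(z)] with [K] analytic, and the Schur complement [M] of
    [Q^-1] in [P_X] solves the Stein equation [M - A M A^* = E E^* - F F^*].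

    If [M >= 0], factor [M = L L^*]; then [AL E] and [L F] have equal Gram matrices,
    so a contraction maps one to the other, and its transfer function is the
    required [S].  Conversely, for a vector [v] and [r < 1] close to [1], put
    [x(z) = (1 - z r^-2 A^* )^-1 v].  On [|z| = r] the real part of the analytic
    function [2 v^* M x - v^* M v - 2 z v^* K F^* x] is, up to [O(r^-2 - 1)], at
    least [|E^* x - S F^* x|^2], and its value at [0] is [v^* M v]; the mean value
    property gives [v^* M v >= 0].  That property is obtained from Goursat's theorem
    in logarithmic coordinates, which requires no continuity of the derivative. *)

Require Import Defs.
From HB Require Import structures.
From mathcomp Require Import all_boot all_order all_algebra.
From mathcomp Require Import spectral complex.
From mathcomp Require Import all_classical all_reals all_analysis.
From mathcomp Require Import zify ring lra.
Set Implicit Arguments.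
Unset Strict Implicit.
Unset Printing Implicit Defensive.
Import Order.TTheory GRing.Theory Num.Theory.
Import numFieldNormedType.Exports.
Local Open Scope classical_set_scope.
Local Open Scope ring_scope.
Local Open Scope sesquilinear_scope.

(** The obstacle in the necessity part is the analyticity of [K]. Its rows at the nodes [z i] are
    difference quotients of [S], and when holomorphy means bare complex differentiability, such a
    quotient is known to be continuous at [z i] but not differentiable there. The mean value
    property is therefore proved for functions with one exceptional point, where continuity alone is
    assumed, and then passed to sums of functions with different exceptional points. The rows at the
    [lambda j] raise no such difficulty: membership in C + B H^oo supplies an analytic quotient
    outright. Circles of radius less than 1 stand in for the boundary values of [S], at the cost of
    the error term in r^-2 - 1. The Schur complement depends on the positivity of [Q], which is
    itself an instance of the necessity argument, with [S = 0], and on its invertibility, which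
    comes from the distinctness of the [lambda j]. *)

Local Notation "x %:C" := (real_complex _ x) : ring_scope.

(** * Goursat's theorem on rectangles *)

Section Goursat.
Variable R : realType.
Local Notation mu := (@lebesgue_measure R).

Lemma continuous_itv_integrable (f : R -> R) (a b : R) :
  (forall x, a <= x <= b -> {for x, continuous f}) ->
  mu.-integrable `[a, b] (EFin \o f).
Proof.
move=> fc; apply: continuous_compact_integrable; first exact: segment_compact.
by apply: continuous_in_subspaceT => x /set_mem /=; rewrite in_itv; apply: fc.
Qed.

Lemma Rintegral_itv_cst (c a b : R) : a <= b ->
  \int[mu]_(x in `[a, b]) c = c * (b - a).
Proof.
move=> ab; have <- : fine (mu `[a, b]) = b - a.
  by rewrite lebesgue_measure_itv /= lte_fin; case: ltgtP ab => //= -> _; rewrite subrr.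
exact: Rintegral_cst.
Qed.

Lemma Rintegral_near_cst (f : R -> R) (a b k e : R) : a <= b ->
  (forall x, a <= x <= b -> {for x, continuous f}) ->
  (forall x, a <= x <= b -> `|f x - k| <= e) ->
  `|\int[mu]_(x in `[a, b]) f x - k * (b - a)| <= e * (b - a).
Proof.
move=> ab fc fk; have fi := continuous_itv_integrable fc.
have ci (c : R) : mu.-integrable `[a, b] (EFin \o cst c).
  by apply: continuous_itv_integrable => x _; exact: cvg_cst.
have cI c := Rintegral_itv_cst c ab.
rewrite -(cI k) -RintegralB //; last exact: ci.
have di : mu.-integrable `[a, b] (EFin \o (fun x => f x - k)).
  exact: (integrableB _ fi (ci k)).
rewrite ler_norml -mulNr -!cI; apply/andP; split.
  apply: le_Rintegral => //; first exact: ci.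
  by move=> x; rewrite /= in_itv /= => /fk; rewrite ler_norml => /andP[].
apply: le_Rintegral => //; first exact: ci.
by move=> x; rewrite /= in_itv /= => /fk; rewrite ler_norml => /andP[].
Qed.

Lemma Rintegral_itv_split (f : R -> R) (a m b : R) : a <= m -> m <= b ->
  (forall x, a <= x <= b -> {for x, continuous f}) ->
  \int[mu]_(x in `[a, b]) f x =
  \int[mu]_(x in `[a, m]) f x + \int[mu]_(x in `[m, b]) f x.
Proof.
move=> am mb fc; have fi := continuous_itv_integrable fc.
have := @Rintegral_itvB R f (BLeft a) (BRight b) m fi.
rewrite !bnd_simp => /(_ am mb) H.
have H2 : \int[mu]_(x in `]m, b]) f x = \int[mu]_(x in `[m, b]) f x.
  apply: Rintegral_itv_obnd_cbnd; apply: integrableS fi => //.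
  by apply: subset_itvr; rewrite bnd_simp.
by rewrite -H2 -H addrC subrK.
Qed.

(* [U + iV], as a function of [s + it], is complex differentiable at [s + it],
   with derivative [p + iq]. *)
Definition complex_diff_at (U V : R -> R -> R) (s t : R) :=
  exists p q : R, forall e : R, 0 < e -> exists2 d : R, 0 < d & forall s' t' : R,
    `|s' - s| <= d -> `|t' - t| <= d ->
    `|U s' t' - U s t - (p * (s' - s) - q * (t' - t))| <=
      e * (`|s' - s| + `|t' - t|) /\
    `|V s' t' - V s t - (q * (s' - s) + p * (t' - t))| <=
      e * (`|s' - s| + `|t' - t|).

Lemma affine_approx_continuous (f : R -> R) (x k e d : R) : 0 < d ->
  (forall y, `|y - x| <= d -> `|f y - f x - k * (y - x)| <= e * `|y - x|) ->
  {for x, continuous f}.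
Proof.
move=> d0 fk; apply/cvgrPdist_le => h h0 /=.
have k0 : 0 < `|k| + `|e| + 1 by rewrite ltr_wpDl // addr_ge0.
have m0 : 0 < Num.min d (h / (`|k| + `|e| + 1)) by rewrite lt_min d0 divr_gt0.
near=> y.
have : `|x - y| <= Num.min d (h / (`|k| + `|e| + 1)).
  by near: y; apply: cvgr_dist_le m0; exact: cvg_id.
rewrite distrC.
rewrite le_min => /andP[/fk fy]; rewrite ler_pdivlMr // => yh.
apply: le_trans yh; rewrite -[`|f x - f y|]distrC.
have -> : f y - f x = (f y - f x - k * (y - x)) + k * (y - x) by ring.
apply: (le_trans (ler_normD _ _)); rewrite normrM.
have := normr_ge0 (y - x); have := ler_norm e.
have : 0 <= `|k| by [].
nra.
Unshelve. all: by end_near. Qed.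

Lemma complex_diff_at_continuous (U V : R -> R -> R) (s t : R) :
  complex_diff_at U V s t ->
  [/\ {for s, continuous (U ^~ t)}, {for t, continuous (U s)},
      {for s, continuous (V ^~ t)} & {for t, continuous (V s)}].
Proof.
move=> [p [q /(_ 1 ltr01)[d d0 H]]].
have zd (x : R) : `|x - x| <= d by rewrite subrr normr0 ltW.
split.
- apply: (@affine_approx_continuous _ _ p 1 d) => // y yd.
  by have [+ _] := H y t yd (zd t); rewrite subrr mulr0 subr0 normr0 addr0.
- apply: (@affine_approx_continuous _ _ (- q) 1 d) => // y yd.
  have [+ _] := H s y (zd s) yd.
  by rewrite subrr mulr0 normr0 !add0r mulNr.
- apply: (@affine_approx_continuous _ _ q 1 d) => // y yd.
  by have [_ +] := H y t yd (zd t); rewrite subrr mulr0 normr0 !addr0.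
- apply: (@affine_approx_continuous _ _ p 1 d) => // y yd.
  have [_ +] := H s y (zd s) yd.
  by rewrite subrr mulr0 normr0 !add0r.
Qed.

(* The imaginary part of the integral of [U + iV] along the boundary of the
   rectangle [a, b] x [c, d]. *)
Definition rect_integral (U V : R -> R -> R) (a b c d : R) : R :=
  \int[mu]_(t in `[c, d]) (U b t - U a t) -
  \int[mu]_(s in `[a, b]) (V s d - V s c).

Section Rectangle.
Variables U V : R -> R -> R.
Variables a b c d : R.
Hypothesis diffUV :
  forall s t, a <= s <= b -> c <= t <= d -> complex_diff_at U V s t.

Let Uct s t : a <= s <= b -> c <= t <= d -> {for t, continuous (U s)}.
Proof. by move=> hs ht; have [] := complex_diff_at_continuous (diffUV hs ht). Qed.

Let Vcs s t : a <= s <= b -> c <= t <= d -> {for s, continuous (V ^~ t)}.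
Proof. by move=> hs ht; have [] := complex_diff_at_continuous (diffUV hs ht). Qed.

Let dUc s s' t : a <= s <= b -> a <= s' <= b -> c <= t <= d ->
  {for t, continuous (fun t => U s t - U s' t)}.
Proof. by move=> hs hs' ht; apply: continuousB; exact: Uct. Qed.

Let dVc s t t' : a <= s <= b -> c <= t <= d -> c <= t' <= d ->
  {for s, continuous (fun s => V s t - V s t')}.
Proof. by move=> hs ht ht'; apply: (@continuousB _ _ _ (V ^~ t) (V ^~ t')); exact: Vcs. Qed.

Lemma rect_integral_split_s x m y e f :
  a <= x -> x <= m -> m <= y -> y <= b -> c <= e -> e <= f -> f <= d ->
  rect_integral U V x y e f =
  rect_integral U V x m e f + rect_integral U V m y e f.
Proof.
move=> ax xm my yb ce ef fd; rewrite /rect_integral.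
rewrite (@Rintegral_itv_split _ x m y) //; last first.
  by move=> s hs; apply: dVc; lra.
have -> : \int[mu]_(t in `[e, f]) (U y t - U x t) =
   \int[mu]_(t in `[e, f]) (U m t - U x t) + \int[mu]_(t in `[e, f]) (U y t - U m t).
  rewrite -RintegralD //; first by apply: eq_Rintegral => t _; ring.
  by apply: continuous_itv_integrable => t ht; apply: dUc; lra.
  by apply: continuous_itv_integrable => t ht; apply: dUc; lra.
by ring.
Qed.

Lemma rect_integral_split_t x y e m f :
  a <= x -> x <= y -> y <= b -> c <= e -> e <= m -> m <= f -> f <= d ->
  rect_integral U V x y e f =
  rect_integral U V x y e m + rect_integral U V x y m f.
Proof.
move=> ax xy yb ce em mf fd; rewrite /rect_integral.
rewrite (@Rintegral_itv_split _ e m f) //; last first.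
  by move=> s hs; apply: dUc; lra.
have -> : \int[mu]_(s in `[x, y]) (V s f - V s e) =
   \int[mu]_(s in `[x, y]) (V s m - V s e) + \int[mu]_(s in `[x, y]) (V s f - V s m).
  rewrite -RintegralD //; first by apply: eq_Rintegral => t _; ring.
  by apply: continuous_itv_integrable => t ht; apply: dVc; lra.
  by apply: continuous_itv_integrable => t ht; apply: dVc; lra.
by ring.
Qed.

(** For the affine part both integrals equal [p (y - x) (f - e)], by the Cauchy-Riemann form of the
    derivative, and they cancel. What remains is an error at each of the two endpoints of a
    difference, hence the factor 2, which is at most [eps] times the half-perimeter and is
    integrated over sides that add up to the half-perimeter again. *)
Lemma rect_integral_affine_bound x y e f s t p q eps :
  a <= x -> x <= y -> y <= b -> c <= e -> e <= f -> f <= d -> 0 <= eps ->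
  x <= s <= y -> e <= t <= f ->
  (forall s' t', x <= s' <= y -> e <= t' <= f ->
    `|U s' t' - U s t - (p * (s' - s) - q * (t' - t))| <=
      eps * (`|s' - s| + `|t' - t|) /\
    `|V s' t' - V s t - (q * (s' - s) + p * (t' - t))| <=
      eps * (`|s' - s| + `|t' - t|)) ->
  `|rect_integral U V x y e f| <= 2 * eps * ((y - x) + (f - e)) ^+ 2.
Proof.
move=> ax xy yb ce ef fd eps0 hs ht H.
have B s' t' : x <= s' <= y -> e <= t' <= f ->
    eps * (`|s' - s| + `|t' - t|) <= eps * ((y - x) + (f - e)).
  move=> hs' ht'; apply: ler_wpM2l => //; apply: lerD; rewrite ler_norml; lra.
pose K := 2 * eps * ((y - x) + (f - e)).
have HU : `|\int[mu]_(t in `[e, f]) (U y t - U x t) - (p * (y - x)) * (f - e)|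
    <= K * (f - e).
  apply: Rintegral_near_cst => // [t' ht'|t' ht']; first by apply: dUc; lra.
  have hy : x <= y <= y by lra. have hx : x <= x <= y by lra.
  have [H1 _] := H _ _ hy ht'. have [H2 _] := H _ _ hx ht'.
  have := le_trans H1 (B _ _ hy ht'); have := le_trans H2 (B _ _ hx ht').
  by rewrite !ler_norml /K; lra.
have HV : `|\int[mu]_(s in `[x, y]) (V s f - V s e) - (p * (f - e)) * (y - x)|
    <= K * (y - x).
  apply: Rintegral_near_cst => // [t' ht'|t' ht']; first by apply: dVc; lra.
  have hy : e <= f <= f by lra. have hx : e <= e <= f by lra.
  have [_ H1] := H _ _ ht' hy. have [_ H2] := H _ _ ht' hx.
  have := le_trans H1 (B _ _ ht' hy); have := le_trans H2 (B _ _ ht' hx).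
  by rewrite !ler_norml /K; lra.
move: HU HV; rewrite /rect_integral.
set iu := Rintegral _ _ _; set iv := Rintegral _ _ _.
have -> : 2 * eps * ((y - x) + (f - e)) ^+ 2 = K * (f - e) + K * (y - x) by rewrite /K; ring.
by rewrite !ler_norml; lra.
Qed.

(** One of the four quarters of a rectangle keeps at least a quarter of the integral, while the
    bound of [rect_integral_affine_bound] at the common point of the nested rectangles also shrinks
    by 4 at each step, with a factor [eps] to spare. *)
Theorem goursat : a <= b -> c <= d -> rect_integral U V a b c d = 0.
Proof.
move=> ab cd; apply: contrapT => /eqP w0.
pose eta := `|rect_integral U V a b c d|.
have eta0 : 0 < eta by rewrite normr_gt0.
pose l n : R := (b - a) / 2 ^+ n; pose h n : R := (d - c) / 2 ^+ n.
have lS n : l n = l n.+1 + l n.+1 by rewrite /l exprS; field; rewrite expf_neq0.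
have hS n : h n = h n.+1 + h n.+1 by rewrite /h exprS; field; rewrite expf_neq0.
have l0 n : 0 <= l n by rewrite /l divr_ge0 ?subr_ge0 // exprn_ge0.
have h0 n : 0 <= h n by rewrite /h divr_ge0 ?subr_ge0 // exprn_ge0.
pose bad n (w : R * R) := [/\ a <= w.1, w.1 + l n <= b, c <= w.2, w.2 + h n <= d &
  eta / 4 ^+ n <= `|rect_integral U V w.1 (w.1 + l n) w.2 (w.2 + h n)|].
(* The existential stands outside the implication, so that [choice] gives a total map, iterated from
   [(a, c)]; a pair that is not bad may go anywhere. *)
have step (nw : nat * (R * R)) : exists w' : R * R, bad nw.1 nw.2 ->
  [/\ bad nw.1.+1 w', nw.2.1 <= w'.1, w'.1 + l nw.1.+1 <= nw.2.1 + l nw.1,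
     nw.2.2 <= w'.2 & w'.2 + h nw.1.+1 <= nw.2.2 + h nw.1].
  case: nw => n [x y] /=; have [[/= ax xb cy yd B]|nb] := pselect (bad n (x, y)); last by exists (x, y).
  have := l0 n.+1; have := h0 n.+1; set L := l n.+1; set H := h n.+1 => H0 L0.
  move: xb yd B; rewrite lS hS -/L -/H !addrA => xb yd.
  rewrite (@rect_integral_split_s x (x + L) (x + L + L)); try lra.
  rewrite (@rect_integral_split_t x (x + L) y (y + H) (y + H + H)); try lra.
  rewrite (@rect_integral_split_t (x + L) (x + L + L) y (y + H) (y + H + H)); try lra.
  set r1 := rect_integral _ _ _ _ _ _; set r2 := rect_integral _ _ _ _ _ _.
  set r3 := rect_integral _ _ _ _ _ _; set r4 := rect_integral _ _ _ _ _ _ => B.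
  have e4 : eta / 4 ^+ n = 4 * (eta / 4 ^+ n.+1) by rewrite exprS; field; rewrite expf_neq0.
  have : eta / 4 ^+ n.+1 <= `|r1| \/ eta / 4 ^+ n.+1 <= `|r2| \/
         eta / 4 ^+ n.+1 <= `|r3| \/ eta / 4 ^+ n.+1 <= `|r4|.
    move: B; rewrite e4; set ee := eta / _ => B.
    have := ler_normD (r1 + r2) (r3 + r4); have := ler_normD r1 r2; have := ler_normD r3 r4.
    case: (lerP ee `|r1|); first by left. case: (lerP ee `|r2|); first by right; left.
    case: (lerP ee `|r3|); first by right; right; left.
    case: (lerP ee `|r4|); first by right; right; right.
    lra.
  case=> [?|[?|[?|?]]]; [exists (x, y) | exists (x, y + H) | exists (x + L, y) | exists (x + L, y + H)];
  by move=> _; split=> /=; rewrite -?/L -?/H; try lra; split=> /=; rewrite -?/L -?/H //; lra.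
have [nxt nxtP] := choice step.
pose w := fix w n := if n is n'.+1 then nxt (n', w n') else (a, c).
have wbad n : bad n (w n).
  elim: n => [|n IH]; last by have [] := nxtP (n, w n) IH.
  split => //=; rewrite /l /h ?expr0 ?divr1; try lra.
  by rewrite !(addrC _ (_ - _)) !subrK.
have wS n := nxtP (n, w n) (wbad n).
have nest k n : [/\ (w n).1 <= (w (k + n)%N).1,
    (w (k + n)%N).1 + l (k + n)%N <= (w n).1 + l n,
    (w n).2 <= (w (k + n)%N).2 & (w (k + n)%N).2 + h (k + n)%N <= (w n).2 + h n].
  elim: k => [|k [IH1 IH2 IH3 IH4]]; first by rewrite add0n; split.
  rewrite addSn; have [_ S1 S2 S3 S4] := wS (k + n)%N.
  by move: S1 S2 S3 S4 => /= *; split; lra.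
(* Every lower corner lies below every upper corner, whatever the order of the indices, so the
   suprema of the lower corners lie in all the rectangles. *)
have bnd i j : (w i).1 <= (w j).1 + l j /\ (w i).2 <= (w j).2 + h j.
  have [N1 N2 N3 N4] := nest i j; have [M1 M2 M3 M4] := nest j i.
  have := l0 (i + j)%N; have := h0 (i + j)%N; rewrite addnC in M1 M2 M3 M4.
  by split; lra.
pose s := sup (range (fun n => (w n).1)); pose t := sup (range (fun n => (w n).2)).
have sup1 : has_sup (range (fun n => (w n).1)).
  by split; [exists (w 0%N).1, 0%N | exists ((w 0%N).1 + l 0%N) => _ [n _ <-]; apply: (bnd n 0%N).1].
have sup2 : has_sup (range (fun n => (w n).2)).
  by split; [exists (w 0%N).2, 0%N | exists ((w 0%N).2 + h 0%N) => _ [n _ <-]; apply: (bnd n 0%N).2].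
have sP n : (w n).1 <= s <= (w n).1 + l n.
  apply/andP; split; first by apply: ub_le_sup; [exact: sup1.2 | exists n].
  by apply: ge_sup; [exact: sup1.1 | move=> _ [k _ <-]; apply: (bnd k n).1].
have tP n : (w n).2 <= t <= (w n).2 + h n.
  apply/andP; split; first by apply: ub_le_sup; [exact: sup2.2 | exists n].
  by apply: ge_sup; [exact: sup2.1 | move=> _ [k _ <-]; apply: (bnd k n).2].
have [p [q D]] : complex_diff_at U V s t.
  have [/= A1 A2 A3 A4 _] := wbad 0%N; have := sP 0%N; have := tP 0%N.
  by move=> /= ? ?; apply: diffUV; lra.
(* The summand 1 keeps [T] positive for a degenerate rectangle; [eps] is chosen so that [2 eps T^2]
   is half of [eta]. *)
pose T := (b - a) + (d - c) + 1; have T0 : 0 < T by rewrite /T; lra.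
pose eps := eta / (4 * T ^+ 2).
have eps0 : 0 < eps by rewrite divr_gt0 // mulr_gt0 // exprn_gt0.
have [dl dl0 D'] := D eps eps0.
have [n nd] : exists n, T / 2 ^+ n < dl.
  have : (fun n : nat => T * (2^-1) ^+ n) @ \oo --> (T * 0 : R).
    by apply: cvgMr; apply: cvg_expr; rewrite ger0_norm ?invr_ge0 // invf_lt1 // ltr1n.
  rewrite mulr0 => /cvgr_lt /(_ _ dl0) [N _ HN].
  by exists N; have := HN N (leqnn N); rewrite exprVn.
have TLH : b - a <= T /\ d - c <= T
  by rewrite /T; split; [rewrite -addrA lerDl|rewrite addrAC lerDr];
    rewrite addr_ge0 // subr_ge0.
have ln : l n <= T / 2 ^+ n by rewrite /l ler_pM2r ?invr_gt0 ?exprn_gt0 //; case: TLH.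
have hn : h n <= T / 2 ^+ n by rewrite /h ler_pM2r ?invr_gt0 ?exprn_gt0 //; case: TLH.
have [/= A1 A2 A3 A4 B] := wbad n.
have := @rect_integral_affine_bound (w n).1 ((w n).1 + l n) (w n).2 ((w n).2 + h n) s t.
have := l0 n; have := h0 n; have := sP n; have := tP n => tPn sPn hn0 ln0.
have ne : 2 * eps * ((l n) + (h n)) ^+ 2 < eta / 4 ^+ n.
  have -> : l n + h n = (T - 1) / 2 ^+ n by rewrite /l /h /T; field; rewrite expf_neq0.
  rewrite expr_div_n -exprM mulnC exprM (_ : 2 ^+ 2 = 4); last by ring.
  rewrite mulrA ltr_pM2r ?invr_gt0 ?exprn_gt0 //.
  have -> : eta = 2 * eps * T ^+ 2 + 2 * eps * T ^+ 2.
    by rewrite /eps; field; rewrite lt0r_neq0.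
  have T1 : (T - 1) ^+ 2 <= T ^+ 2.
    have T10 : 0 <= T - 1 by rewrite /T addrK addr_ge0 // subr_ge0.
    by rewrite ler_sqr ?nnegrE // ?gerBl // ltW.
  have E0 : 0 < 2 * eps by rewrite mulr_gt0.
  apply: (@le_lt_trans _ _ (2 * eps * T ^+ 2)); first by rewrite ler_pM2l.
  by rewrite ltrDl mulr_gt0 // exprn_gt0.
rewrite ![_ + _ - _]addrAC !subrr !add0r => K.
have : `|rect_integral U V (w n).1 ((w n).1 + l n) (w n).2 ((w n).2 + h n)| <=
    2 * eps * (l n + h n) ^+ 2.
  apply: (K p q eps A1 _ A2 A3 _ A4 (ltW eps0) sPn tPn) => [||s' t' hs' ht'].
  - by rewrite lerDl.
  - by rewrite lerDl.
  - by apply: D'; rewrite ler_norml; lra.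
by move/(le_trans B); rewrite leNgt ne.
Qed.

End Rectangle.
End Goursat.

(** * Complex differentiability in logarithmic coordinates *)

Section MeanValue.
Variable R : realType.
Local Notation mu := (@lebesgue_measure R).
Local Notation C := R[i].

Lemma eq_ler (x y : R) : x = y -> x <= y. Proof. by move=> ->. Qed.

(** Stated over any numeric field, since it serves both the real functions [expR], [cos], [sin] and
    the complex ones; the radius is halved to pass from an open ball to a closed one. *)
Lemma is_derive_bound (K : numFieldType) (f : K^o -> K^o) (x c : K) :
  is_derive (x : K^o) (1 : K^o) f c ->
  forall e : K, 0 < e -> exists2 d : K, 0 < d &
    forall y, `|y - x| <= d -> `|f y - f x - c * (y - x)| <= e * `|y - x|.
Proof.
move=> [df dfc] e e0.
have : (fun h => h^-1 *: (f (h *: (1 : K^o) + x) - f x)) @ (0 : K)^' --> (c : K^o).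
  by rewrite -dfc; exact: df.
move=> /cvgrPdist_le /(_ e e0) /nbhs_ballP[d /= d0 H].
exists (d / 2) => [|y yd]; first by rewrite divr_gt0.
have [->|yx] := eqVneq y x; first by rewrite !subrr mulr0 subrr normr0 mulr0.
have h0 : y - x != 0 by rewrite subr_eq0.
have /H /(_ h0) : ball 0 d (y - x).
  rewrite /ball /= sub0r normrN; apply: le_lt_trans yd _.
  by rewrite ltr_pdivrMr // ltr_pMr // ltr1n.
rewrite /= -/(_ *: (1 : K^o)) [_ *: (1 : K^o)]mulr1 subrK distrC => H'.
have -> : f y - f x - c * (y - x) = ((y - x)^-1 *: (f y - f x) - c) * (y - x).
  by rewrite mulrBl /GRing.scale /= mulrAC mulVf // mul1r.
by rewrite normrM ler_wpM2r.
Qed.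

Local Notation normc := (@Normc.normc R).

Lemma normcE_norm (z : C) : `|z| = (normc z)%:C. Proof. by []. Qed.

Lemma normc_ge0 (z : C) : 0 <= normc z.
Proof. by rewrite -lecR -normcE_norm normr_ge0. Qed.

Lemma normc_real (x : R) : normc x%:C = `|x|.
Proof. by rewrite /Normc.normc /= expr0n /= addr0 sqrtr_sqr. Qed.

Lemma normc_le_ReIm (z : C) : normc z <= `|complex.Re z| + `|complex.Im z|.
Proof.
case: z => a b /=; rewrite -[leRHS]ger0_norm ?addr_ge0 // -sqrtr_sqr.
rewrite ler_sqrt ?sqr_ge0 // sqrrD !real_normK ?num_real // addrAC lerDl.
by rewrite mulrn_wge0 // mulr_ge0.
Qed.

Lemma Re_le_normc (z : C) : `|complex.Re z| <= normc z.
Proof.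
case: z => a b /=; rewrite -sqrtr_sqr ler_sqrt ?addr_ge0 ?sqr_ge0 //.
by rewrite lerDl sqr_ge0.
Qed.

Lemma Im_le_normc (z : C) : `|complex.Im z| <= normc z.
Proof.
case: z => a b /=; rewrite -sqrtr_sqr ler_sqrt ?addr_ge0 ?sqr_ge0 //.
by rewrite lerDr sqr_ge0.
Qed.

Lemma gt0_complex_real (d : C) : 0 < d -> d = (complex.Re d)%:C /\ 0 < complex.Re d.
Proof.
by case: d => a b; rewrite ltcE /= => /andP[/eqP -> a0]; split.
Qed.

Lemma cdiff_bound (f : C -> C) (z : C) : derivable (f : C^o -> C^o) z 1 ->
  exists c : C, forall e : R, 0 < e -> exists2 d : R, 0 < d &
    forall w, normc (w - z) <= d ->
      normc (f w - f z - c * (w - z)) <= e * normc (w - z).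
Proof.
move=> /derivableP df; exists ('D_1 (f : C^o -> C^o) (z : C^o)) => e e0.
have e0' : 0 < e%:C by rewrite ltcR.
have [d /gt0_complex_real[-> d0] H] := is_derive_bound df e0'.
exists (complex.Re d) => // w wd.
by have := H w; rewrite !normcE_norm -rmorphM !lecR; apply.
Qed.

Lemma ccont_bound (f : C -> C) (z : C) : {for z, continuous (f : C^o -> C^o)} ->
  forall e : R, 0 < e -> exists2 d : R, 0 < d &
    forall w, normc (w - z) <= d -> normc (f w - f z) <= e.
Proof.
move=> /cvgrPdist_le fc e e0; have e0' : 0 < e%:C by rewrite ltcR.
have /nbhs_ballP[d /= /gt0_complex_real[-> d0] H] := fc _ e0'.
exists (complex.Re d / 2) => [|w wd]; first by rewrite divr_gt0.
have /H /= : ball (z : C^o) (complex.Re d)%:C (w : C^o).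
  rewrite /ball /= distrC normcE_norm ltcR; apply: le_lt_trans wd _.
  by rewrite ltr_pdivrMr // ltr_pMr // ltr1n.
by rewrite distrC normcE_norm lecR.
Qed.

Lemma derivable_ccontinuous (f : C -> C) (z : C) :
  derivable (f : C^o -> C^o) z 1 -> {for z, continuous (f : C^o -> C^o)}.
Proof. by move=> /derivable1_diffP /differentiable_continuous. Qed.

Definition cis (t : R) : C := (cos t +i* sin t)%C.

Definition cexp (s t : R) : C := (expR s)%:C * cis t.

Lemma cis0 : cis 0 = 1. Proof. by rewrite /cis cos0 sin0. Qed.

Lemma cis_2pi : cis (2 * pi) = 1.
Proof. by rewrite /cis mulr_natl cos2pi sin2pi. Qed.

Lemma normc_cis t : normc (cis t) = 1.
Proof. by rewrite /= cos2Dsin2 sqrtr1. Qed.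

Lemma cisD s t : cis (s + t) = cis s * cis t.
Proof.
rewrite /cis cosD sinD; apply/eqP; rewrite eq_complex /= eqxx /=.
by rewrite addrC.
Qed.

Lemma cexpD s t s' t' : cexp (s + s') (t + t') = cexp s t * cexp s' t'.
Proof. by rewrite /cexp expRD cisD rmorphM /= !mulrA; congr (_ * _); rewrite mulrAC. Qed.

Lemma normc_cexp s t : normc (cexp s t) = expR s.
Proof. by rewrite Normc.normcM normc_cis mulr1 normc_real ger0_norm ?expR_ge0. Qed.

(** By the functional equation [cexpD], differentiability of the exponential at 0 carries over to
    every point. *)
Lemma cexp_diff0 (e : R) : 0 < e -> exists2 d : R, 0 < d & forall s t,
  `|s| <= d -> `|t| <= d -> normc (cexp s t - 1 - (s +i* t)%C) <= e * (`|s| + `|t|).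
Proof.
move=> e0.
(* The error terms in [|t|] have coefficients 3 + 3 + 2 = 8 and the one in [|s|] has coefficient 1;
   [e1 <= 1] also keeps [E] at most 3 in absolute value. *)
have [e1 [e10 e11 e1e]] : exists e1, [/\ 0 < e1, e1 <= 1 & e1 <= e / 8].
  exists (Num.min 1 (e / 8)).
  by rewrite lt_min ltr01 divr_gt0 // !ge_min !lexx orbT.
have dE : is_derive (0 : R^o) (1 : R^o) (expR : R^o -> R^o) 1.
  by apply: is_derive_eq (is_derive_expR 0) _; rewrite expR0.
have dC : is_derive (0 : R^o) (1 : R^o) (cos : R^o -> R^o) 0.
  by apply: is_derive_eq (is_derive_cos 0) _; rewrite sin0 oppr0.
have dS : is_derive (0 : R^o) (1 : R^o) (sin : R^o -> R^o) 1.
  by apply: is_derive_eq (is_derive_sin 0) _; rewrite cos0.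
have [d1 d10 H1] := is_derive_bound dE e10.
have [d2 d20 H2] := is_derive_bound dC e10.
have [d3 d30 H3] := is_derive_bound dS e10.
exists (Num.min e1 (Num.min d1 (Num.min d2 d3))).
  by rewrite !lt_min e10 d10 d20 d30.
move=> s t; rewrite !le_min => /and4P[s0 s1 _ _] /and4P[t0 _ t2 t3].
have := H1 s; rewrite expR0 !subr0 mul1r => /(_ s1).
have := H2 t; rewrite cos0 mul0r !subr0 => /(_ t2).
have := H3 t; rewrite sin0 mul1r !subr0 => /(_ t3).
set E := expR s; set c := cos t; set u := sin t => hS hC hE.
have E3 : `|E| <= 3.
  have := ler_normD (E - 1 - s) (1 + s); have := ler_normD 1 s.
  rewrite normr1 (_ : E - 1 - s + (1 + s) = E); last by ring.
  have : e1 * `|s| <= 1 * 1 by rewrite ler_pM // ?(le_trans s0) // ltW.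
  by lra.
apply: (le_trans (normc_le_ReIm _)) => /=.
rewrite !mul0r !subr0 !addr0 -/E -/c -/u.
have -> : E * c - 1 - s = (E - 1 - s) + E * (c - 1) by ring.
have -> : E * u - t = E * (u - t) + ((E - 1 - s) + s) * t by ring.
have n1 := normr_ge0 s; have n2 := normr_ge0 t.
have hEc : `|E * (c - 1)| <= 3 * (e1 * `|t|) by rewrite normrM ler_pM.
have hEu : `|E * (u - t)| <= 3 * (e1 * `|t|) by rewrite normrM ler_pM.
have hEs : `|E - 1 - s + s| <= 2 * e1.
  apply: (le_trans (ler_normD _ _)).
  have : e1 * `|s| <= 1 * `|s| by rewrite ler_wpM2r.
  by lra.
have hEst : `|(E - 1 - s + s) * t| <= 2 * e1 * `|t| by rewrite normrM ler_wpM2r.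
have := ler_normD (E - 1 - s) (E * (c - 1)).
have := ler_normD (E * (u - t)) ((E - 1 - s + s) * t).
have es : e1 * `|s| <= e / 8 * `|s| by rewrite ler_wpM2r.
have et : e1 * `|t| <= e / 8 * `|t| by rewrite ler_wpM2r.
have : 0 <= e * `|s| by rewrite mulr_ge0 // ltW.
have : 0 <= e * `|t| by rewrite mulr_ge0 // ltW.
lra.
Qed.

Lemma complex_diff_at_cexp (f : C -> C) (s t : R) :
  derivable (f : C^o -> C^o) (cexp s t) 1 ->
  complex_diff_at (fun s t => complex.Re (f (cexp s t)))
                  (fun s t => complex.Im (f (cexp s t))) s t.
Proof.
move=> /cdiff_bound[c Hf]; set w := cexp s t.
(* Chain rule: the exponential is its own derivative, so that of the composite is [c * w]. *)
exists (complex.Re (c * w)), (complex.Im (c * w)) => e e0.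
pose n := normc c; pose N := normc w.
have n0 : 0 <= n := normc_ge0 c. have N0 : 0 <= N := normc_ge0 w.
(* Half of [e] pays for the error of the exponential, amplified by [n * N], and half for the error
   of [f], where the increment of [cexp] is at most [2 * N * D]. *)
have [e1 [e10 e11 e1n]] : exists e1, [/\ 0 < e1, e1 <= 1 & n * N * e1 <= e / 2].
  exists (Num.min 1 (e / 2 / (n * N + 1))); split.
  - by rewrite lt_min ltr01 !divr_gt0 // ltr_wpDl // mulr_ge0.
  - by rewrite ge_min lexx.
  - apply: (@le_trans _ _ ((n * N + 1) * (e / 2 / (n * N + 1)))); last first.
      by rewrite mulrCA mulfV ?mulr1 // gt_eqF // ltr_wpDl // mulr_ge0.
    by apply: ler_pM; rewrite ?mulr_ge0 ?le_min ?ler01 ?ge_min ?lexx ?orbT ?lerDl //;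
      rewrite divr_ge0 ?addr_ge0 ?mulr_ge0 // ltW // divr_gt0.
have [d1 d10 H1] := cexp_diff0 e10.
have e20 : 0 < e / (4 * (N + 1)) by rewrite divr_gt0 // mulr_gt0 // ltr_wpDl.
have [d2 d20 H2] := Hf _ e20.
have dd : 0 < d2 / (4 * (N + 1)) by rewrite divr_gt0 // mulr_gt0 // ltr_wpDl.
exists (Num.min d1 (d2 / (4 * (N + 1)))); first by rewrite lt_min d10.
move=> s' t'; rewrite !le_min => /andP[s1 s2] /andP[t1 t2].
have := H1 _ _ s1 t1; set ds := s' - s; set dt := t' - t; set D := `|ds| + `|dt|.
have D0 : 0 <= D by rewrite addr_ge0.
have w'E : cexp s' t' = w * cexp ds dt by rewrite -cexpD !(addrC _ (_ - _)) !subrK.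
set r := cexp ds dt - 1 - (ds +i* dt)%C => hr.
have wdE : cexp s' t' - w = w * r + w * (ds +i* dt)%C by rewrite w'E /r; ring.
have hst : normc (ds +i* dt)%C <= D by exact: normc_le_ReIm.
have hw : normc (cexp s' t' - w) <= 2 * N * D.
  rewrite wdE; apply: (le_trans (le_normcD _ _)).
  rewrite (Normc.normcM w r) (Normc.normcM w (ds +i* dt)%C) -/N.
  have : N * normc r <= N * D.
    by rewrite ler_wpM2l // (le_trans hr) // ler_piMl.
  have : N * normc (ds +i* dt)%C <= N * D by rewrite ler_wpM2l.
  by lra.
have N1 : 0 < N + 1 by rewrite ltr_wpDl.
have hw2 : normc (cexp s' t' - w) <= d2.
  apply: (le_trans hw).
  have D2 : D <= 2 * (d2 / (4 * (N + 1))) by rewrite /D; lra.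
  apply: (@le_trans _ _ (2 * (N + 1) * (2 * (d2 / (4 * (N + 1)))))).
    by apply: ler_pM => //; rewrite ?mulr_ge0 // ler_pM2l // lerDl.
  by apply: eq_ler; field; rewrite gt_eqF.
have := H2 _ hw2; set g := f _ - f _ - _ => hg.
have key : f (cexp s' t') - f w - c * w * (ds +i* dt)%C = g + c * w * r.
  have -> : c * w * r = c * (cexp s' t' - w) - c * w * (ds +i* dt)%C by rewrite wdE; ring.
  by rewrite /g -/w; ring.
have bnd : normc (g + c * w * r) <= e * D.
  apply: (le_trans (le_normcD _ _)).
  rewrite (Normc.normcM (c * w) r) (Normc.normcM c w) -/n -/N.
  have b1 : n * N * normc r <= e / 2 * D.
    apply: (@le_trans _ _ (n * N * (e1 * D))); first by rewrite ler_wpM2l // mulr_ge0.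
    by rewrite mulrA ler_wpM2r.
  have b2 : normc g <= e / 2 * D.
    apply: (le_trans hg).
    apply: (@le_trans _ _ (e / (4 * (N + 1)) * (2 * (N + 1) * D))).
      apply: ler_wpM2l; first exact: ltW.
      by apply: (le_trans hw); rewrite ler_wpM2r // ler_pM2l // lerDl.
    by apply: eq_ler; field; rewrite gt_eqF.
  by lra.
have hR := le_trans (Re_le_normc _) bnd; have hI := le_trans (Im_le_normc _) bnd.
move: hR hI; rewrite -key -/w; case: (f (cexp s' t')) => a1 b1.
case: (f w) => a2 b2; case: (c * w) => a3 b3 /= hR hI.
split; [apply: le_trans hR|apply: le_trans hI];
  by apply: eq_ler; congr (`|_|); ring.
Qed.

End MeanValue.

(** * The mean value property on circles *)

Section CircleMean.
#[local] Arguments Normc.normc : simpl never.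

Variable R : realType.
Local Notation mu := (@lebesgue_measure R).
Local Notation C := R[i].
Local Notation normc := (@Normc.normc R).

Lemma normc_polar (p t : R) : 0 <= p -> normc (p%:C * cis t) = p.
Proof. by move=> p0; rewrite Normc.normcM normc_cis mulr1 normc_real ger0_norm. Qed.

Lemma polar_dist (p q s t : R) : 0 <= q ->
  normc (p%:C * cis s - q%:C * cis t) <=
  `|p - q| + q * (`|cos s - cos t| + `|sin s - sin t|).
Proof.
move=> q0; have -> : p%:C * cis s - q%:C * cis t =
    (p - q)%:C * cis s + q%:C * (cis s - cis t) by rewrite rmorphB /=; ring.
apply: (le_trans (le_normcD _ _)).
rewrite (Normc.normcM (p - q)%:C) (Normc.normcM q%:C) normc_cis mulr1.
rewrite !normc_real (ger0_norm q0) lerD2l ler_wpM2l //.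
exact: normc_le_ReIm.
Qed.

(** Closeness is joint in the angle and the radius, as a compactness argument over the angles
    requires; [p + 1] replaces [p] in the denominator because [p = 0] is allowed. *)
Lemma polar_near (p : R) (t e : R) : 0 <= p -> 0 < e ->
  \forall t' \near t & q \near p, normc (q%:C * cis t' - p%:C * cis t) <= e.
Proof.
move=> p0 e0; have e1 : 0 < e / (2 * (p + 1)) / 2.
  by rewrite !divr_gt0 // mulr_gt0 // ltr_wpDl.
have e2 : 0 < e / 2 by rewrite divr_gt0.
near=> t' q => /=.
apply: (le_trans (polar_dist _ _ _ p0)).
have hq : `|p - q| <= e / 2 by near: q; apply: cvgr_dist_le e2; exact: cvg_id.
have hc : `|cos t - cos t'| <= e / (2 * (p + 1)) / 2.
  by near: t'; apply: cvgr_dist_le e1; exact: continuous_cos.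
have hs : `|sin t - sin t'| <= e / (2 * (p + 1)) / 2.
  by near: t'; apply: cvgr_dist_le e1; exact: continuous_sin.
rewrite (distrC q) (distrC (cos t')) (distrC (sin t')).
have : p * (`|cos t - cos t'| + `|sin t - sin t'|) <= (p + 1) * (e / (2 * (p + 1))).
  by rewrite ler_pM ?addr_ge0 ?lerDl //; lra.
rewrite [X in _ <= X -> _](_ : _ = e / 2); last by field; rewrite gt_eqF // ltr_wpDl.
by lra.
Unshelve. all: by end_near. Qed.

(** Not normalised: this is 2 pi times the mean value of the real part. *)
Definition circle_mean (f : C -> C) (p : R) : R :=
  \int[mu]_(t in `[0, 2 * pi]) complex.Re (f (p%:C * cis t)).

Lemma two_pi_ge0 : 0 <= 2 * pi :> R.
Proof. by rewrite mulr_ge0 // pi_ge0. Qed.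

Lemma circle_continuous (f : C -> C) (p : R) : 0 <= p ->
  (forall z, normc z = p -> {for z, continuous (f : C^o -> C^o)}) ->
  forall t, {for t, continuous (fun t => complex.Re (f (p%:C * cis t)))}.
Proof.
move=> p0 fc t; apply/cvgrPdist_le => e e0.
have [d d0 H] := ccont_bound (fc _ (normc_polar t p0)) e0.
have [[A B] /= [A1 B1] AB] := polar_near t p0 d0.
apply: filterS A1 => t' At'.
have h := H (p%:C * cis t') (AB (t', p) (conj At' (nbhs_singleton B1))).
rewrite distrC; apply: le_trans h; rewrite -raddfB; exact: Re_le_normc.
Qed.

(** The radius 0 is included: continuity there links the mean over small circles to the value at the
    centre. *)
Lemma circle_mean_continuous (f : C -> C) (r p e : R) : 0 <= p <= r ->
  (forall z, normc z <= r -> {for z, continuous (f : C^o -> C^o)}) -> 0 < e ->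
  exists2 d : R, 0 < d & forall q, 0 <= q <= r -> `|q - p| < d ->
    `|circle_mean f q - circle_mean f p| <= e.
Proof.
move=> /andP[p0 pr] fc e0.
have e1 : 0 < e / (2 * pi) by rewrite divr_gt0 // mulr_gt0 // pi_gt0.
(* Compactness of the interval of angles gives one neighbourhood of [p] that works for all of
   them. *)
have : \forall q \near p, forall t, t \in `[0, 2 * pi] ->
    normc (f (q%:C * cis t) - f (p%:C * cis t)) <= e / (2 * pi).
  have := (compact_near_coveringP _).1 (@segment_compact R 0 (2 * pi)) R (nbhs p)
    (fun q t => normc (f (q%:C * cis t) - f (p%:C * cis t)) <= e / (2 * pi)).
  apply => t _.
  have e2 : 0 < e / (2 * pi) / 2 by rewrite divr_gt0.
  have ft : {for p%:C * cis t, continuous (f : C^o -> C^o)}.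
    by apply: fc; rewrite normc_polar.
  have [d d0 H] := ccont_bound ft e2.
  have [[A B] /= [A1 B1] AB] := polar_near t p0 d0.
  exists (A, B) => // -[t' q] /= [At' Bq].
  have h1 := H (q%:C * cis t') (AB (t', q) (conj At' Bq)).
  have h2 := H (p%:C * cis t') (AB (t', p) (conj At' (nbhs_singleton B1))).
  have -> : f (q%:C * cis t') - f (p%:C * cis t') =
    (f (q%:C * cis t') - f (p%:C * cis t)) - (f (p%:C * cis t') - f (p%:C * cis t)) by ring.
  by apply: (le_trans (le_normcD _ _)); rewrite normcN; lra.
move=> /nbhs_ballP[d /= d0 H]; exists d => // q /andP[q0 qr] qp.
have {H} H t : 0 <= t <= 2 * pi ->
    normc (f (q%:C * cis t) - f (p%:C * cis t)) <= e / (2 * pi).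
  by move=> ht; apply: H; rewrite ?in_itv //; rewrite /ball /= distrC.
have cq := @circle_continuous f q q0; have cp := @circle_continuous f p p0.
have {}cq : forall t, {for t, continuous (fun t => complex.Re (f (q%:C * cis t)))}.
  by apply: cq => z zq; apply: fc; rewrite zq.
have {}cp : forall t, {for t, continuous (fun t => complex.Re (f (p%:C * cis t)))}.
  by apply: cp => z zq; apply: fc; rewrite zq.
rewrite /circle_mean -RintegralB //.
- have := @Rintegral_near_cst R (fun t => complex.Re (f (q%:C * cis t)) -
    complex.Re (f (p%:C * cis t))) 0 (2 * pi) 0 (e / (2 * pi)) two_pi_ge0.
  rewrite mul0r !subr0 divfK; last by rewrite gt_eqF // mulr_gt0 // pi_gt0.
  apply => t ht; first by apply: continuousB; [exact: cq|exact: cp].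
  by rewrite subr0 -raddfB (le_trans (Re_le_normc _)) // H.
- by apply: continuous_itv_integrable => t _; exact: cq.
- by apply: continuous_itv_integrable => t _; exact: cp.
Qed.

(* In the coordinates [s + it = log z] the annulus becomes a rectangle, and by
   periodicity the contributions of its two sides [t = 0] and [t = 2 pi] cancel. *)
Lemma circle_mean_annulus (f : C -> C) (p q : R) : 0 < p -> p <= q ->
  (forall z, p <= normc z <= q -> derivable (f : C^o -> C^o) z 1) ->
  circle_mean f p = circle_mean f q.
Proof.
move=> p0 pq fd; have q0 := lt_le_trans p0 pq.
have D s t : ln p <= s <= ln q -> 0 <= t <= 2 * pi ->
    complex_diff_at (fun s t => complex.Re (f (cexp s t)))
                  (fun s t => complex.Im (f (cexp s t))) s t.
  move=> /andP[h1 h2] _; apply: complex_diff_at_cexp; apply: fd.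
  rewrite normc_cexp -(@lnK _ p) ?posrE // -(@lnK _ q) ?posrE //.
  by rewrite !ler_expR h1.
have lpq : ln p <= ln q by rewrite ler_ln ?posrE.
have := goursat D lpq two_pi_ge0; rewrite /rect_integral /cexp !lnK ?posrE //.
rewrite cis_2pi cis0.
under [X in _ - X = _ -> _]eq_Rintegral do rewrite subrr.
have -> : \int[mu]_(s in `[ln p, ln q]) (0 : R) = 0.
  by rewrite /Rintegral integral0.
rewrite subr0 RintegralB //.
- by move/eqP; rewrite subr_eq0 => /eqP.
- apply: continuous_itv_integrable => t _; apply: circle_continuous (ltW q0) _ _.
  by move=> z zq; apply: derivable_ccontinuous; apply: fd; rewrite zq pq lexx.
- apply: continuous_itv_integrable => t _; apply: circle_continuous (ltW p0) _ _.
  by move=> z zq; apply: derivable_ccontinuous; apply: fd; rewrite zq pq lexx.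
Qed.

Lemma circle_mean0 (f : C -> C) : circle_mean f 0 = 2 * pi * complex.Re (f 0).
Proof.
rewrite /circle_mean; under eq_Rintegral do rewrite rmorph0 mul0r.
by rewrite Rintegral_itv_cst ?two_pi_ge0 // subr0 mulrC.
Qed.

(* The mean is constant on either side of the circle through the exceptional point
   [w], and it is continuous in the radius. *)
Theorem circle_mean_value (f : C -> C) (w : C) (r : R) : 0 < r ->
  (forall z, normc z <= r -> {for z, continuous (f : C^o -> C^o)}) ->
  (forall z, normc z <= r -> z != w -> derivable (f : C^o -> C^o) z 1) ->
  circle_mean f r = 2 * pi * complex.Re (f 0).
Proof.
move=> r0 fc fd; rewrite -circle_mean0.
(* Goursat's theorem needs a positive inner radius, for the logarithm, and a closed annulus that
   avoids [w]. It is applied between [a + d] and [b - d], and the end radii are reached by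
   continuity of the mean. *)
have step (a b : R) : 0 <= a -> a <= b -> b <= r ->
    normc w <= a \/ b <= normc w -> circle_mean f a = circle_mean f b.
  move=> a0; rewrite le_eqVlt => /predU1P[->//|ab] br hw.
  apply/eqP; rewrite -subr_eq0 -normr_le0; apply/ler_addgt0Pr => e e0; rewrite add0r.
  have e2 : 0 < e / 2 by rewrite divr_gt0.
  have ha : 0 <= a <= r by lra. have hb : 0 <= b <= r by lra.
  have [d1 d10 H1] := circle_mean_continuous ha fc e2.
  have [d2 d20 H2] := circle_mean_continuous hb fc e2.
  pose d := Num.min ((b - a) / 2) (Num.min d1 d2) / 2.
  have d0 : 0 < d by rewrite divr_gt0 // !lt_min d10 d20 divr_gt0 // subr_gt0.
  have [dba dd1 dd2] : [/\ d <= (b - a) / 4, d < d1 & d < d2].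
    have : [/\ 2 * d <= (b - a) / 2, 2 * d <= d1 & 2 * d <= d2].
      by rewrite /d mulrC divfK // !ge_min !lexx !orbT.
    by case => ? ? ?; split; lra.
  have := H1 (a + d); rewrite addrAC subrr add0r gtr0_norm // dd1.
  have := H2 (b - d); rewrite addrAC subrr add0r normrN gtr0_norm // dd2.
  rewrite (@circle_mean_annulus f (a + d) (b - d)); last 3 first.
  - lra.
  - lra.
  - move=> z hz; apply: fd; first by lra.
    by apply/eqP => zw; move: hz; rewrite zw; case: hw => ?; lra.
  have h1 : 0 <= a + d <= r by lra. have h2 : 0 <= b - d <= r by lra.
  rewrite h1 h2 => /(_ isT isT) A /(_ isT isT) B.
  by move: A B; rewrite !ler_norml; lra.
have n0 := normc_ge0 w.
have [wr|rw] := leP (normc w) r; last first.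
  by apply/esym/step => //; [exact: ltW | right; exact: ltW].
apply/esym; transitivity (circle_mean f (normc w)).
  by apply: step => //; right.
by apply: step => //; left.
Qed.

(* The functions whose real part satisfies the mean value property on the
   circle of radius [r]; unlike differentiability, this is stable under sums of
   functions with distinct exceptional points. *)
Definition mean_valued (r : R) (f : C -> C) : Prop :=
  (forall z, normc z = r -> {for z, continuous (f : C^o -> C^o)}) /\
  circle_mean f r = 2 * pi * complex.Re (f 0).

Lemma mean_valuedD (r : R) (f g : C -> C) : 0 < r ->
  mean_valued r f -> mean_valued r g -> mean_valued r (fun z => f z + g z).
Proof.
move=> r0 [fc fm] [gc gm]; split.
  by move=> z zr; apply: (@continuousD _ C^o C^o f g); [exact: fc|exact: gc].
rewrite raddfD mulrDr -fm -gm /circle_mean -RintegralD //.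
- by apply: eq_Rintegral => t _; rewrite raddfD.
- apply: continuous_itv_integrable => t _; exact: circle_continuous (ltW r0) fc _.
- apply: continuous_itv_integrable => t _; exact: circle_continuous (ltW r0) gc _.
Qed.

Lemma mean_valued_sum (r : R) (I : Type) (s : seq I) (f : I -> C -> C) : 0 < r ->
  (forall i, mean_valued r (f i)) -> mean_valued r (fun z => \sum_(i <- s) f i z).
Proof.
move=> r0 fm; elim: s => [|i s IH].
  rewrite (_ : (fun z => _) = cst 0); last by apply/funext => z; rewrite big_nil.
  split; first by move=> z _; exact: (@cst_continuous C^o C^o).
  by rewrite /circle_mean Rintegral_itv_cst ?two_pi_ge0 // mul0r mulr0.
rewrite (_ : (fun z => _) = (fun z => f i z + \sum_(j <- s) f j z)); last first.
  by apply/funext => z; rewrite big_cons.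
exact: mean_valuedD.
Qed.

Lemma mean_valued_ge (r e : R) (f : C -> C) : 0 < r -> mean_valued r f ->
  (forall z, normc z = r -> e <= complex.Re (f z)) -> e <= complex.Re (f 0).
Proof.
move=> r0 [fc fm] fe.
have p0 : 0 < 2 * pi :> R by rewrite mulr_gt0 // pi_gt0.
rewrite -(ler_pM2l p0) -fm /circle_mean.
have -> : 2 * pi * e = \int[mu]_(t in `[0, 2 * pi]) e.
  by rewrite Rintegral_itv_cst ?two_pi_ge0 // subr0 mulrC.
apply: le_Rintegral => //.
- by apply: continuous_itv_integrable => t _; exact: cvg_cst.
- by apply: continuous_itv_integrable => t _; exact: circle_continuous (ltW r0) fc _.
- by move=> t _; apply: fe; rewrite normc_polar // ltW.
Qed.

End CircleMean.

(** * Hermitian matrices and Stein equations *)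

Section Adjoint.
Variable C : numClosedFieldType.

Lemma adjmxM m n p (A : 'M[C]_(m, n)) (B : 'M[C]_(n, p)) :
  (A *m B) ^t* = B ^t* *m A ^t*.
Proof. by rewrite trmx_mul map_mxM. Qed.

Lemma adjmxD m n (A B : 'M[C]_(m, n)) : (A + B) ^t* = A ^t* + B ^t*.
Proof. by rewrite linearD map_mxD. Qed.

Lemma adjmxN m n (A : 'M[C]_(m, n)) : (- A) ^t* = - A ^t*.
Proof. by rewrite linearN map_mxN. Qed.

Lemma adjmxB m n (A B : 'M[C]_(m, n)) : (A - B) ^t* = A ^t* - B ^t*.
Proof. by rewrite adjmxD adjmxN. Qed.

Lemma adjmxZ m n a (A : 'M[C]_(m, n)) : (a *: A) ^t* = a^* *: A ^t*.
Proof. by rewrite linearZ map_mxZ. Qed.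

Lemma adjmx0 m n : (0 : 'M[C]_(m, n)) ^t* = 0.
Proof. by rewrite trmx0 map_mx0. Qed.

Lemma adjmx1 n : (1%:M : 'M[C]_n) ^t* = 1%:M.
Proof. by rewrite trmx1 map_mx1. Qed.

Lemma adjmx_scalar n a : (a%:M : 'M[C]_n) ^t* = a^*%:M.
Proof. by rewrite tr_scalar_mx map_scalar_mx. Qed.

Lemma adjmx_unit n (A : 'M[C]_n) : (A ^t* \in unitmx) = (A \in unitmx).
Proof. by rewrite map_unitmx unitmx_tr. Qed.

Definition sqnorm k (v : 'cV[C]_k) : C := (v ^t* *m v) 0 0.

Lemma sqnormE k (v : 'cV[C]_k) : sqnorm v = \sum_i `|v i 0| ^+ 2.
Proof. by rewrite /sqnorm mxE; apply: eq_bigr => i _; rewrite !mxE mulrC normCK. Qed.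

Lemma sqnorm_ge0 k (v : 'cV[C]_k) : 0 <= sqnorm v.
Proof. by rewrite sqnormE sumr_ge0 // => i _; rewrite exprn_ge0. Qed.

Lemma sqnorm_eq0 k (v : 'cV[C]_k) : (sqnorm v == 0) = (v == 0).
Proof.
apply/idP/eqP => [|->]; last by rewrite /sqnorm mulmx0 mxE.
rewrite sqnormE psumr_eq0 => [|i _]; last by rewrite exprn_ge0.
move=> /allP v0; apply/matrixP => i j; rewrite ord1 mxE.
by apply/eqP; have := v0 i (mem_index_enum i); rewrite /= sqrf_eq0 normr_eq0.
Qed.

Lemma sqnormZ k a (v : 'cV[C]_k) : sqnorm (a *: v) = `|a| ^+ 2 * sqnorm v.
Proof.
by rewrite !sqnormE mulr_sumr; apply: eq_bigr => i _; rewrite mxE normrM exprMn.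
Qed.

Lemma sqnorm_col_mx k l (u : 'cV[C]_k) (v : 'cV[C]_l) :
  sqnorm (col_mx u v) = sqnorm u + sqnorm v.
Proof. by rewrite /sqnorm tr_col_mx map_row_mx mul_row_col mxE. Qed.

Lemma mul_adjmx_eq0 m n (Z : 'M[C]_(m, n)) : Z *m Z ^t* = 0 -> Z = 0.
Proof.
move=> Z0; apply/matrixP => i j; rewrite mxE.
have : (Z *m Z ^t*) i i = 0 by rewrite Z0 mxE.
rewrite mxE => /eqP; rewrite psumr_eq0 => [|k _]; last by rewrite !mxE mul_conjC_ge0.
move=> /allP /(_ j (mem_index_enum j)) /=.
by rewrite !mxE -normCK sqrf_eq0 normr_eq0 => /eqP.
Qed.

Lemma hermitian_spectral n (M : 'M[C]_n) : M ^t* = M ->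
  exists P : 'M[C]_n, exists2 d : 'rV[C]_n,
    P \is unitarymx & M = P ^t* *m diag_mx d *m P.
Proof.
move=> hM; have /orthomx_spectralP eM : M \is normalmx by apply/normalmxP; rewrite hM.
exists (spectralmx M), (spectral_diag M); first exact: spectral_unitarymx.
by rewrite -invmx_unitary ?spectral_unitarymx.
Qed.

Lemma adjmx_diag n (d : 'rV[C]_n) : (diag_mx d) ^t* = diag_mx (map_mx Num.conj d).
Proof. by rewrite tr_diag_mx map_diag_mx. Qed.

Lemma unitary_conjK n (P D M : 'M[C]_n) : P \is unitarymx ->
  M = P ^t* *m D *m P -> D = P *m M *m P ^t*.
Proof.
move=> uP ->; rewrite !mulmxA (unitarymxP uP) mul1mx -mulmxA.
by rewrite (unitarymxP uP) mulmx1.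
Qed.

Lemma psd_factor n (M : 'M[C]_n) : M ^t* = M ->
  (forall v : 'cV[C]_n, 0 <= (v ^t* *m M *m v) 0 0) -> exists L : 'M[C]_n, M = L *m L ^t*.
Proof.
move=> hM pM; have [P [d uP eM]] := hermitian_spectral hM.
have eD := unitary_conjK uP eM.
have d0 j : 0 <= d 0 j.
  have -> : d 0 j = diag_mx d j j by rewrite mxE eqxx mulr1n.
  pose v : 'cV[C]_n := P ^t* *m delta_mx j 0.
  have := pM v; rewrite /v adjmxM trmxCK !mulmxA -(mulmxA _ P) -(mulmxA _ (P *m M)) -eD.
  have -> : (delta_mx j 0 : 'cV[C]_n) ^t* = delta_mx 0 j.
    by rewrite trmx_delta; apply/matrixP => a b; rewrite !mxE rmorph_nat.
  by rewrite -rowE -colE !mxE.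
pose s : 'rV[C]_n := \row_j sqrtC (d 0 j).
exists (P ^t* *m diag_mx s).
rewrite adjmxM trmxCK adjmx_diag !mulmxA -(mulmxA _ (diag_mx s)) mulmx_diag {1}eM.
congr (_ *m diag_mx _ *m _); apply/rowP => j; rewrite !mxE.
by rewrite geC0_conj ?sqrtC_ge0 // -expr2 sqrtCK.
Qed.

Lemma hermitian_pinv n (G : 'M[C]_n) : G ^t* = G ->
  exists H : 'M[C]_n, [/\ H ^t* = H, G *m H *m G = G & H *m G *m H = H].
Proof.
move=> hG; have [P [d uP eG]] := hermitian_spectral hG.
have eD := unitary_conjK uP eG.
have dR : map_mx Num.conj d = d.
  apply/rowP => j; have : (diag_mx d) ^t* j j = diag_mx d j j.
    by rewrite {1}eD !adjmxM trmxCK hG mulmxA -eD.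
  by rewrite adjmx_diag !mxE eqxx !mulr1n.
(* Since [0^-1 = 0], inverting the diagonal entrywise yields the Moore-Penrose inverse. *)
pose e : 'rV[C]_n := \row_j (d 0 j)^-1.
have PP : P *m P ^t* = 1%:M := unitarymxP uP.
exists (P ^t* *m diag_mx e *m P); split.
- rewrite !adjmxM trmxCK adjmx_diag mulmxA; congr (_ *m diag_mx _ *m _).
  by apply/rowP => j; rewrite !mxE fmorphV -{2}dR mxE.
- rewrite eG !mulmxA; do 2 rewrite -(mulmxA _ P (P ^t*)) PP mulmx1.
  congr (_ *m _); rewrite -!mulmxA; congr (_ *m _); rewrite !mulmx_diag.
  congr diag_mx; apply/rowP => j; rewrite !mxE; have [->|d0] := eqVneq (d 0 j) 0.
    by rewrite !mul0r.
  by rewrite mulVf // mulr1.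
- rewrite eG !mulmxA; do 2 rewrite -(mulmxA _ P (P ^t*)) PP mulmx1.
  congr (_ *m _); rewrite -!mulmxA; congr (_ *m _); rewrite !mulmx_diag.
  congr diag_mx; apply/rowP => j; rewrite !mxE; have [->|d0] := eqVneq (d 0 j) 0.
    by rewrite invr0 !mul0r.
  by rewrite mulfV // mulr1.
Qed.

(** [T] is an orthogonal projection, and the defect is the squared norm of the complementary
    component [x - T x]. *)
Lemma projection_contractive n (T : 'M[C]_n) (x : 'cV[C]_n) :
  T ^t* = T -> T *m T = T -> (x ^t* *m T *m x) 0 0 <= sqnorm x.
Proof.
move=> hT TT; rewrite -subr_ge0.
suff -> : sqnorm x - (x ^t* *m T *m x) 0 0 = sqnorm (x - T *m x) by exact: sqnorm_ge0.
rewrite /sqnorm adjmxB adjmxM hT mulmxBl !mulmxBr !mulmxA -(mulmxA _ T T) TT.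
by rewrite subrr subr0 !mxE.
Qed.

(* Douglas' lemma for equal Gram matrices. *)
Lemma contraction_of_gram_eq n p q (M : 'M[C]_(n, p)) (N : 'M[C]_(n, q)) :
  M *m M ^t* = N *m N ^t* ->
  exists2 U : 'M[C]_(p, q), M *m U = N & forall x, sqnorm (U *m x) <= sqnorm x.
Proof.
move=> MN; set G := M *m M ^t* in MN.
have hG : G ^t* = G by rewrite /G adjmxM trmxCK.
have [H [hH GHG HGH]] := hermitian_pinv hG.
(* The Gram matrix of [(1 - G H) N] is [(1 - G H) G (1 - H G)], which vanishes. *)
have NN : N = G *m H *m N.
  apply/eqP; rewrite -subr_eq0 -{1}[N]mul1mx -mulmxBl; apply/eqP/mul_adjmx_eq0.
  rewrite adjmxM adjmxB adjmx1 adjmxM hH hG !mulmxA -(mulmxA _ N) -MN.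
  by rewrite [_ *m G]mulmxBl mul1mx GHG subrr mul0mx.
(* [U] is the pseudo-inverse of [M] times [N], and [U^* U = N^* H N] is an orthogonal projection. *)
exists (M ^t* *m H *m N) => [|x].
  by rewrite !mulmxA -/G -NN.
have -> : sqnorm (M ^t* *m H *m N *m x) = (x ^t* *m (N ^t* *m H *m N) *m x) 0 0.
  rewrite /sqnorm !adjmxM trmxCK hH !mulmxA -(mulmxA _ M) -/G.
  by rewrite -(mulmxA _ H G) -(mulmxA _ (H *m G)) HGH.
apply: projection_contractive; first by rewrite !adjmxM trmxCK hH mulmxA.
rewrite !mulmxA -(mulmxA _ N) -MN -(mulmxA _ H G) -(mulmxA _ (H *m G)) HGH.
by [].
Qed.

(* Every eigenvalue of [A] lies in the open unit disk. *)
Definition disk_stable n (A : 'M[C]_n) : Prop :=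
  forall w : C, `|w| <= 1 -> 1%:M - w *: A \in unitmx.

Lemma disk_stable_adj n (A : 'M[C]_n) : disk_stable A -> disk_stable (A ^t*).
Proof.
move=> sA w w1; rewrite -adjmx_unit adjmxB adjmx1 adjmxZ trmxCK.
by apply: sA; rewrite norm_conjC.
Qed.

(** The weak inequality suffices: [disk_stable B] inverts [1 - a B] on the whole closed disk. *)
Lemma disk_stable_eigenvalue n (A : 'M[C]_n) (a : C) :
  disk_stable A -> root (char_poly A) a -> `|a| <= 1.
Proof.
move=> sA ra; rewrite real_leNgt ?real1 ?normr_real //; apply/negP => a1.
have a0 : a != 0 by rewrite -normr_gt0 (lt_trans ltr01).
have : `|a^-1| <= 1 by rewrite normfV invf_le1 ?ltW // normr_gt0.
move/sA; rewrite unitmxE unitfE; apply/negP/negPn.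
have -> : 1%:M - a^-1 *: A = a^-1 *: (a%:M - A).
  by rewrite scalerBr scale_scalar_mx mulVf.
rewrite detZ mulf_eq0; apply/orP; right.
move: ra; rewrite /root /char_poly -horner_evalE -det_map_mx /=.
rewrite (_ : map_mx _ _ = a%:M - A) //; apply/matrixP => i j.
by rewrite !mxE /= /horner_eval !hornerE hornerMn hornerX.
Qed.

(* [A X B = X] gives [(A - a) X = A X (1 - a B)], with an invertible last factor if
   [|a| <= 1]; conclude with Cayley-Hamilton for [A]. *)
Lemma stein_injective n p (A : 'M[C]_n) (B : 'M[C]_p) (X : 'M[C]_(n, p)) :
  disk_stable A -> disk_stable B -> A *m X *m B = X -> X = 0.
Proof.
move=> sA sB; case: n A X sA => [A X _ _|n A X sA]; first exact: flatmx0.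
have [s es] := closed_field_poly_normal (char_poly A).
have mon : lead_coef (char_poly A) = 1 by apply/eqP/char_poly_monic.
have rs : {in s, forall a, `|a| <= 1}.
  move=> a ain; apply: (disk_stable_eigenvalue sA).
  by rewrite es mon scale1r root_prod_XsubC.
have : horner_mx A (char_poly A) *m X = 0 by rewrite Cayley_Hamilton mul0mx.
rewrite es mon scale1r; clear es; move: X; elim: s rs => [|a s IH] rs X.
  by rewrite big_nil rmorph1 -[1]/(1%:M) mul1mx.
rewrite big_cons mulrC rmorphM rmorphB /= horner_mx_X horner_mx_C => H AXB.
have Y0 : (A - a%:M) *m X = 0.
  apply: IH => [b bs||]; first by apply: rs; rewrite inE bs orbT.
    by rewrite mulmxA.
  have cA : A *m (A - a%:M) = (A - a%:M) *m A.
    by rewrite mulmxBr mulmxBl scalar_mxC.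
  by rewrite mulmxA cA -!mulmxA (mulmxA A) AXB.
have : A *m X *m (1%:M - a *: B) = 0.
  rewrite mulmxBr mulmx1 -scalemxAr AXB.
  by move: Y0; rewrite mulmxBl mul_scalar_mx.
move/(congr1 (mulmx^~ (invmx (1%:M - a *: B)))).
rewrite mulmxK ?mul0mx; last by apply: sB; apply: rs; rewrite inE eqxx.
by move=> AX; rewrite -AXB AX mul0mx.
Qed.

Lemma stein_unique n p (A : 'M[C]_n) (B : 'M[C]_p) (X Y : 'M[C]_(n, p)) :
  disk_stable A -> disk_stable B ->
  X - A *m X *m B = Y - A *m Y *m B -> X = Y.
Proof.
move=> sA sB e; apply/eqP; rewrite -subr_eq0; apply/eqP.
apply: (stein_injective sA sB); rewrite mulmxBr mulmxBl.
apply/esym/eqP; rewrite -subr_eq0; apply/eqP.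
transitivity (X - A *m X *m B - (Y - A *m Y *m B)); last by rewrite e subrr.
by rewrite !opprB addrACA [RHS]addrACA [- Y - _]addrC.
Qed.

(** In finite dimension, the trivial kernel given by [stein_injective] makes the matrix of
    [X - A X B] invertible. *)
Lemma stein_exists n p (A : 'M[C]_n) (B : 'M[C]_p) (Y : 'M[C]_(n, p)) :
  disk_stable A -> disk_stable B -> exists X, X - A *m X *m B = Y.
Proof.
move=> sA sB; pose f := (idfun \- (mulmxr B \o mulmx A) : {linear 'M[C]_(n, p) -> 'M[C]_(n, p)})%R.
have fE X : f X = X - A *m X *m B by [].
have free : row_free (lin_mx f).
  rewrite -kermx_eq0; apply/eqP/row_matrixP => i; rewrite row0.
  set u := row i _; have : u *m lin_mx f = 0 by apply/sub_kermxP; exact: row_sub.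
  rewrite -[u]vec_mxK mul_vec_lin => /(canRL (@mxvecK _ _ _)); rewrite linear0 fE.
  move/eqP; rewrite subr_eq0 => /eqP e.
  by rewrite (stein_injective sA sB (esym e)) linear0.
exists (vec_mx (mxvec Y *m invmx (lin_mx f))); rewrite -fE.
apply: (can_inj mxvecK); rewrite -mul_vec_lin vec_mxK mulmxKV //.
by rewrite -row_free_unit.
Qed.

End Adjoint.

(** * Calculus of complex derivability *)

Section ComplexDerivable.
Variable R : realType.
Local Notation C := R[i].
Implicit Types (f g : C -> C) (z : C).

(* An inductive wrapper, because [derivable] unfolds to a product that unification
   would explore. *)
Variant cderivable f z : Prop :=
  CDerivable of derivable (f : C^o -> C^o) z 1.

Lemma cderivableP f z : cderivable f z <-> derivable (f : C^o -> C^o) z 1.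
Proof. by split=> [[]|/CDerivable]. Qed.

Lemma cderivable_cst c z : cderivable (fun=> c) z.
Proof. by apply/cderivableP; exact: (@derivable_cst C C^o C^o c). Qed.

Lemma cderivable_id z : cderivable (fun z => z) z.
Proof. by apply/cderivableP; exact: (@derivable_id C C^o). Qed.

Lemma cderivableD f g z : cderivable f z -> cderivable g z ->
  cderivable (fun z => f z + g z) z.
Proof.
move=> /cderivableP df /cderivableP dg; apply/cderivableP.
exact (@derivableD C C^o C^o f g z 1 df dg).
Qed.

Lemma cderivableB f g z : cderivable f z -> cderivable g z ->
  cderivable (fun z => f z - g z) z.
Proof.
move=> /cderivableP df /cderivableP dg; apply/cderivableP.
exact (@derivableB C C^o C^o f g z 1 df dg).
Qed.

Lemma cderivableM f g z : cderivable f z -> cderivable g z ->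
  cderivable (fun z => f z * g z) z.
Proof.
move=> /cderivableP df /cderivableP dg; apply/cderivableP.
exact (@derivableM C C^o f g z 1 df dg).
Qed.

Lemma cderivableV f z : f z != 0 -> cderivable f z ->
  cderivable (fun z => (f z)^-1) z.
Proof.
move=> f0 /cderivableP df; apply/cderivableP; exact (@derivableV C C^o f z 1 f0 df).
Qed.

Lemma cderivableX f n z : cderivable f z -> cderivable (fun z => f z ^+ n) z.
Proof.
move=> df; elim: n => [|n IH].
  by under [X in cderivable X]funext do rewrite expr0; exact: cderivable_cst.
by under [X in cderivable X]funext do rewrite exprS; exact: (cderivableM df IH).
Qed.

Lemma cderivable_sum (I : Type) (s : seq I) (f : I -> C -> C) z :
  (forall i, cderivable (f i) z) -> cderivable (fun z => \sum_(i <- s) f i z) z.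
Proof.
move=> df; elim: s => [|i s IH].
  rewrite (_ : (fun z => _) = (fun=> 0)); last by apply/funext => w; rewrite big_nil.
  exact: cderivable_cst.
rewrite (_ : (fun z => _) = (fun z => f i z + \sum_(j <- s) f j z)).
  exact: (cderivableD (df i) IH).
by apply/funext => w; rewrite big_cons.
Qed.

Lemma cderivable_prod (I : Type) (s : seq I) (f : I -> C -> C) z :
  (forall i, cderivable (f i) z) -> cderivable (fun z => \prod_(i <- s) f i z) z.
Proof.
move=> df; elim: s => [|i s IH].
  rewrite (_ : (fun z => _) = (fun=> 1)); last by apply/funext => w; rewrite big_nil.
  exact: cderivable_cst.
rewrite (_ : (fun z => _) = (fun z => f i z * \prod_(j <- s) f j z)).
  exact: (cderivableM (df i) IH).
by apply/funext => w; rewrite big_cons.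
Qed.

Lemma cderivable_horner (p : {poly C}) z : cderivable (horner p) z.
Proof.
elim/poly_ind: p => [|p c IH].
  rewrite (_ : horner _ = (fun=> 0)); last by apply/funext => w; rewrite horner0.
  exact: cderivable_cst.
rewrite (_ : horner _ = (fun w => p.[w] * w + c)).
  exact: (cderivableD (cderivableM IH (cderivable_id z)) (cderivable_cst c z)).
by apply/funext => w; rewrite !hornerE.
Qed.

Lemma cderivable_near f g z (d : R) : 0 < d ->
  (forall w, Normc.normc (w - z) < d -> f w = g w) -> cderivable f z -> cderivable g z.
Proof.
move=> d0 fg /cderivableP df; apply/cderivableP; apply: near_eq_derivable df.
have d0' : 0 < d%:C by rewrite ltcR.
apply/nbhs_ballP; exists d%:C => //= w; rewrite /ball /= => wd; apply: fg.
by rewrite -ltcR -[_%:C]/`|w - z| distrC.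
Qed.

Lemma cderivable_continuous f z :
  cderivable f z -> {for z, continuous (f : C^o -> C^o)}.
Proof. by move=> /cderivableP; exact: derivable_ccontinuous. Qed.

End ComplexDerivable.

(** * Resolvents near the closed unit disk *)

Section Resolvent.
Variable R : realType.
Local Notation C := R[i].
Local Notation normc := (@Normc.normc R).
#[local] Arguments Normc.normc : simpl never.

Lemma normcM (x y : C) : normc (x * y) = normc x * normc y.
Proof. exact: Normc.normcM. Qed.

Lemma normcV (x : C) : normc x^-1 = (normc x)^-1.
Proof. exact: Normc.normcV. Qed.

Lemma normcD (x y : C) : normc (x + y) <= normc x + normc y.
Proof. exact: le_normcD. Qed.

Lemma normc_distC (x y : C) : normc (x - y) = normc (y - x).
Proof. by rewrite -normcN opprB. Qed.

Lemma normc_distD (x y : C) : normc x - normc y <= normc (x - y).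
Proof. by rewrite lerBlDr -{1}[x](subrK y) normcD. Qed.

Lemma horner_bounded (p : {poly C}) (T : R) :
  exists2 M : R, 0 <= M & forall w, normc w <= T -> normc p.[w] <= M.
Proof.
elim/poly_ind: p => [|p c [M M0 H]].
  by exists 0 => // w _; rewrite horner0 Normc.normc0.
exists (M * `|T| + normc c) => [|w wT]; first by rewrite addr_ge0 ?mulr_ge0 ?normc_ge0.
rewrite !hornerE; apply: (le_trans (normcD _ _)); rewrite lerD2r normcM.
by rewrite ler_pM ?normc_ge0 ?H // (le_trans wT) // ler_norm.
Qed.

(* The zeros of [p] are finitely many, so a slightly larger disk is free of them. *)
Lemma horner_lower_bound (p : {poly C}) :
  (forall w, normc w <= 1 -> p.[w] != 0) ->
  exists2 T : R, 1 < T & exists2 d : R, 0 < d &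
    forall w, normc w <= T -> d <= normc p.[w].
Proof.
have [s es] := closed_field_poly_normal p; move=> H.
have c0 : lead_coef p != 0.
  rewrite lead_coef_eq0; apply: contraTneq (H 0 _) => [->|]; first by rewrite horner0 eqxx.
  by rewrite Normc.normc0 ler01.
have hs : forall a, a \in s -> 1 < normc a.
  move=> a ain; rewrite ltNge; apply/negP => /H; rewrite es hornerZ mulf_eq0 negb_or c0.
  by rewrite -/(root _ _) root_prod_XsubC ain.
suff [T T1 [d d0 Hd]] : exists2 T : R, 1 < T & exists2 d : R, 0 < d &
    forall w, normc w <= T -> d <= normc (\prod_(a <- s) ('X - a%:P)).[w].
  exists T => //; exists (normc (lead_coef p) * d) => [|w wT].
    by rewrite mulr_gt0 // lt_def normc_ge0 andbT; apply: contra c0 => /eqP/Normc.eq0_normc ->.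
  by rewrite {2}es hornerZ normcM ler_wpM2l ?normc_ge0 // Hd.
elim: s hs {es H} => [|a s IH] hs.
  exists 2; first by rewrite ltr1n.
  by exists 1 => // w _; rewrite big_nil hornerE Normc.normc1.
have [b bs|T T1 [d d0 Hd]] := IH; first by apply: hs; rewrite inE bs orbT.
have a1 : 1 < normc a by apply: hs; rewrite inE eqxx.
exists (Num.min T ((1 + normc a) / 2)); first by rewrite lt_min T1 /=; lra.
exists ((normc a - 1) / 2 * d) => [|w]; first by rewrite mulr_gt0 // divr_gt0 // subr_gt0.
rewrite le_min => /andP[wT wa]; rewrite big_cons hornerM normcM.
rewrite ler_pM ?Hd // ?(ltW d0) //; first by lra.
rewrite hornerXsubC normc_distC; apply: le_trans (normc_distD _ _); lra.
Qed.

Section Matrix.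
Variables (n : nat) (A : 'M[C]_n).

(** Cramer's formula for the inverse makes every entry a quotient of polynomials in [w], from which
    derivability and bounds are both read off. *)
Definition resolvent (w : C) : 'M[C]_n :=
  (\det (1%:M - w *: A))^-1 *: \adj (1%:M - w *: A).

Lemma mul_resolvent w : 1%:M - w *: A \in unitmx ->
  (1%:M - w *: A) *m resolvent w = 1%:M.
Proof.
rewrite unitmxE unitfE => d0; rewrite /resolvent -scalemxAr mul_mx_adj.
by rewrite scale_scalar_mx mulVf.
Qed.

Lemma resolvent0 : resolvent 0 = 1%:M.
Proof. by rewrite /resolvent scale0r subr0 det1 invr1 scale1r adj1. Qed.

Let pencil : 'M[{poly C}]_n := 1%:M - 'X *: map_mx polyC A.

Let pencilE w : map_mx (horner_eval w) pencil = 1%:M - w *: A.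
Proof.
apply/matrixP => i j; rewrite !mxE /= /horner_eval !hornerE.
by rewrite hornerMn hornerC.
Qed.

Let detE w : \det (1%:M - w *: A) = (\det pencil).[w].
Proof. by rewrite -pencilE det_map_mx. Qed.

Let adjE w i j : \adj (1%:M - w *: A) i j = (\adj pencil i j).[w].
Proof. by rewrite -pencilE -map_mx_adj mxE. Qed.

Lemma resolvent_derivable w i j : 1%:M - w *: A \in unitmx ->
  cderivable (fun w => resolvent w i j) w.
Proof.
rewrite unitmxE unitfE detE => d0.
rewrite (_ : (fun w => _) = fun w => ((\det pencil).[w])^-1 * (\adj pencil i j).[w]).
  exact: (cderivableM (cderivableV d0 (cderivable_horner (\det pencil) w))
    (cderivable_horner (\adj pencil i j) w)).
by apply/funext => x; rewrite mxE detE adjE.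
Qed.

(** A radius beyond 1 is required: for [|z| = r < 1] the resolvent is taken at [z / r^2], of modulus
    [1 / r]. *)
Lemma resolvent_bounded : disk_stable A ->
  exists2 T : R, 1 < T & exists2 M : R, 0 <= M &
    forall w, normc w <= T ->
      1%:M - w *: A \in unitmx /\ forall i j, normc (resolvent w i j) <= M.
Proof.
move=> sA; have [w w1|T T1 [d d0 Hd]] := @horner_lower_bound (\det pencil).
  by rewrite -detE -unitfE -unitmxE sA // normcE_norm lecR.
exists T => //.
pose bnd i j := s2val (cid2 (horner_bounded (\adj pencil i j) T)).
have bndP i j : 0 <= bnd i j /\ forall w, normc w <= T -> normc (\adj pencil i j).[w] <= bnd i j.
  by rewrite /bnd; case: cid2.
exists (d^-1 * \sum_i \sum_j bnd i j).
  rewrite mulr_ge0 ?invr_ge0 ?(ltW d0) // sumr_ge0 // => i _; apply: sumr_ge0 => j _.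
  by case: (bndP i j).
move=> w wT; have nd : 0 < normc (\det pencil).[w] := lt_le_trans d0 (Hd w wT).
split.
  rewrite unitmxE unitfE detE; apply: contraTneq nd => ->.
  by rewrite Normc.normc0 ltxx.
move=> i j; rewrite mxE detE adjE normcM normcV; apply: ler_pM.
- by rewrite invr_ge0 ltW.
- exact: normc_ge0.
- by rewrite lef_pV2 // ?posrE // Hd.
- apply: (le_trans ((bndP i j).2 w wT)); rewrite (bigD1 i) //= (bigD1 j) //= -addrA lerDl.
  rewrite addr_ge0 // sumr_ge0 // => [j' _|i' _]; first by case: (bndP i j').
  by apply: sumr_ge0 => j' _; case: (bndP i' j').
Qed.

End Matrix.
End Resolvent.

(** * Contractive matrix functions *)

Section Contractions.
Variable R : realType.
Local Notation C := R[i].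
Local Notation normc := (@Normc.normc R).
#[local] Arguments Normc.normc : simpl never.

Lemma disk_normc (z : C) : disk z = (normc z < 1) :> Prop.
Proof. by rewrite /disk /= normcE_norm ltcR. Qed.

Lemma sqr_vnorm k (v : 'cV[C]_k) : (vnorm v ^+ 2)%:C = sqnorm v.
Proof.
rewrite /vnorm sqr_sqrtr ?sumr_ge0 // => [|i _]; last exact: sqr_ge0.
by rewrite sqnormE rmorph_sum; apply: eq_bigr => i _; rewrite normcE_norm rmorphXn.
Qed.

Lemma vnorm_ge0 k (v : 'cV[C]_k) : 0 <= vnorm v. Proof. exact: sqrtr_ge0. Qed.

Lemma vnorm_le_sqnorm k l (u : 'cV[C]_k) (v : 'cV[C]_l) :
  (vnorm u <= vnorm v) = (sqnorm u <= sqnorm v).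
Proof. by rewrite -!sqr_vnorm lecR ler_sqr // nnegrE vnorm_ge0. Qed.

Lemma vnorm_le1 k (u : 'cV[C]_k) : (vnorm u <= 1) = (sqnorm u <= 1).
Proof.
rewrite -sqr_vnorm (_ : 1 = (1 ^+ 2)%:C); last by rewrite expr1n.
by rewrite lecR ler_sqr // ?nnegrE ?vnorm_ge0.
Qed.

Definition contractive_on_disk k (S : C -> 'M[C]_k) : Prop :=
  forall z, disk z -> forall v : 'cV[C]_k, sqnorm (S z *m v) <= sqnorm v.

Lemma supnorm_le1 k (S : C -> 'M[C]_k) :
  (supnorm S <= 1%:E)%E <-> contractive_on_disk S.
Proof.
split=> [S1 z dz v|cS].
  have [->|v0] := eqVneq v 0; first by rewrite mulmx0.
  have s0 : 0 < sqnorm v by rewrite lt_def sqnorm_eq0 v0 sqnorm_ge0.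
  have n0 : 0 < vnorm v.
    by rewrite -sqr_vnorm ltcR in s0; rewrite lt_def vnorm_ge0 andbT;
       apply: contraTneq s0 => ->; rewrite expr0n ltxx.
  pose a : C := (vnorm v)^-1%:C.
  have aE : `|a| ^+ 2 = (sqnorm v)^-1.
    rewrite -sqr_vnorm /a normcE_norm normc_real ger0_norm ?invr_ge0 ?ltW //.
    by rewrite -rmorphXn -fmorphV /= exprVn.
  have : (opnorm (S z) <= 1%:E)%E.
    by apply: le_trans S1; apply: ereal_sup_ubound; exists z.
  have av : vnorm (a *: v) <= 1 by rewrite vnorm_le1 sqnormZ aE mulVf // gt_eqF.
  have : ((vnorm (S z *m (a *: v)))%:E <= opnorm (S z))%E.
    by apply: ereal_sup_ubound; exists (a *: v).
  move=> /le_trans /[apply]; rewrite lee_fin vnorm_le1 -scalemxAr sqnormZ aE => H.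
  rewrite -(ler_pM2l (_ : 0 < (sqnorm v)^-1)) ?invr_gt0 //.
  by apply: (le_trans H); rewrite mulVf // gt_eqF.
apply: ge_ereal_sup => _ [z dz <-]; apply: ge_ereal_sup => _ [v /= v1 <-].
by rewrite lee_fin (le_trans _ v1) // vnorm_le_sqnorm cS.
Qed.

End Contractions.

Section MatrixDerivable.
Variable R : realType.
Local Notation C := R[i].

Definition mxderivable m n (F : C -> 'M[C]_(m, n)) (z : C) : Prop :=
  forall i j, cderivable (fun z => F z i j) z.

Lemma mxderivable_cst m n (M : 'M[C]_(m, n)) z : mxderivable (fun=> M) z.
Proof. by move=> i j; exact: cderivable_cst. Qed.

Lemma mxderivableM m n p (F : C -> 'M[C]_(m, n)) (G : C -> 'M[C]_(n, p)) z :
  mxderivable F z -> mxderivable G z -> mxderivable (fun z => F z *m G z) z.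
Proof.
move=> dF dG i j.
rewrite (_ : (fun z => _) = (fun z => \sum_l F z i l * G z l j)).
  by apply: cderivable_sum => l; exact: (cderivableM (dF i l) (dG l j)).
by apply/funext => w; rewrite mxE.
Qed.

Lemma mxderivableD m n (F G : C -> 'M[C]_(m, n)) z :
  mxderivable F z -> mxderivable G z -> mxderivable (fun z => F z + G z) z.
Proof.
move=> dF dG i j; rewrite (_ : (fun z => _) = (fun z => F z i j + G z i j)).
  exact: (cderivableD (dF i j) (dG i j)).
by apply/funext => w; rewrite mxE.
Qed.

Lemma mxderivableZ m n (f : C -> C) (F : C -> 'M[C]_(m, n)) z :
  cderivable f z -> mxderivable F z -> mxderivable (fun z => f z *: F z) z.
Proof.
move=> df dF i j; rewrite (_ : (fun z => _) = (fun z => f z * F z i j)).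
  exact: (cderivableM df (dF i j)).
by apply/funext => w; rewrite mxE.
Qed.

End MatrixDerivable.

(** * The boundary identity behind necessity *)

Section PickIdentity.
Variable C : numClosedFieldType.

Lemma mxB00 (M M' : 'M[C]_1) : (M - M') 0 0 = M 0 0 - M' 0 0.
Proof. by rewrite mxE [X in _ + X]mxE. Qed.

Lemma mxZ00 a (M : 'M[C]_1) : (a *: M) 0 0 = a * M 0 0.
Proof. by rewrite mxE. Qed.

Lemma adjmx00 (M : 'M[C]_1) : (M 0 0)^* = (M ^t*) 0 0.
Proof. by rewrite mxE mxE. Qed.

(* On the circle [|z| = r], with [a = z / r^2 = 1 / z^*], the left-hand side is
   [2 Re g + 2 (r^-2 - 1) x^* A P A^* x], where [g] is analytic in [z] if [x] is. *)
Lemma pick_identity N k (A P : 'M[C]_N) (E F K : 'M[C]_(N, k)) (S : 'M[C]_k)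
    (v x : 'cV[C]_N) (z a : C) :
  P ^t* = P -> P - A *m P *m A ^t* = E *m E ^t* - F *m F ^t* ->
  (z%:M - A) *m K = E *m S - F -> z != 0 -> a = (z^*)^-1 ->
  v = x - a *: (A ^t* *m x) ->
  let g := 2 * (v ^t* *m P *m x) 0 0 - (v ^t* *m P *m v) 0 0 -
           2 * z * (v ^t* *m K *m F ^t* *m x) 0 0 in
  let u := E ^t* *m x in let y := F ^t* *m x in
  g + g^* + 2 * (a * z^-1 - 1) * (x ^t* *m (A *m P *m A ^t*) *m x) 0 0 =
  2 * sqnorm (u - S *m y) + 2 * (sqnorm y - sqnorm (S *m y)).
Proof.
move=> hermP steinP interpK z0 aE vE g u y.
have acE : a^* = z^-1 by rewrite aE fmorphV /= conjCK.
have vtE : v ^t* = x ^t* - z^-1 *: (x ^t* *m A).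
  by rewrite vE adjmxB adjmxZ adjmxM trmxCK acE.
have [s1 s1E] : exists s, s = (x ^t* *m P *m x) 0 0 by eexists.
have [q qE] : exists s, s = (x ^t* *m A *m P *m x) 0 0 by eexists.
have [s3 s3E] : exists s, s = (x ^t* *m (A *m P *m A ^t*) *m x) 0 0 by eexists.
have [t tE] : exists s, s = (u ^t* *m (S *m y)) 0 0 by eexists.
have q'E : (x ^t* *m P *m A ^t* *m x) 0 0 = q^*.
  by rewrite qE adjmx00 !adjmxM trmxCK hermP !mulmxA.
have s1R : s1^* = s1 by rewrite s1E adjmx00 !adjmxM trmxCK hermP !mulmxA.
have s3R : s3^* = s3 by rewrite s3E adjmx00 !adjmxM !trmxCK hermP !mulmxA.
have tC : ((S *m y) ^t* *m u) 0 0 = t^* by rewrite tE adjmx00 (adjmxM (u ^t*)) trmxCK.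
have sqR (l : nat) (w : 'cV[C]_l) : (sqnorm w)^* = sqnorm w.
  by apply: geC0_conj; exact: sqnorm_ge0.
have e1 : (v ^t* *m P *m x) 0 0 = s1 - z^-1 * q.
  by rewrite vtE !mulmxBl -!scalemxAl mxB00 mxZ00 -s1E -qE.
have e2 : (v ^t* *m P *m v) 0 0 = s1 - z^-1 * q - a * (q^* - z^-1 * s3).
  rewrite {2}vE mulmxBr -scalemxAr mxB00 mxZ00 e1; congr (_ - _ * _).
  rewrite vtE !mulmxBl -!scalemxAl mxB00 mxZ00 -q'E s3E.
  by rewrite !mulmxA.
(* The equation for [v] gives [z v^* = x^* (z - A)], which explains the factor [z] in [g]: the
   interpolation equation then expresses this term through [S] and [F]. *)
have e3 : z * (v ^t* *m K *m F ^t* *m x) 0 0 = t - sqnorm y.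
  have -> : z * (v ^t* *m K *m F ^t* *m x) 0 0 =
      (x ^t* *m ((z%:M - A) *m K) *m F ^t* *m x) 0 0.
    rewrite -mxZ00 !scalemxAl vtE scalerBr scalerA mulfV // scale1r.
    by rewrite mulmxA mulmxBr scalar_mxC mul_scalar_mx.
  rewrite interpK mulmxBr !mulmxBl mxB00 tE /u /y /sqnorm !adjmxM !trmxCK.
  by rewrite !mulmxA.
have e4 : sqnorm u = s1 - s3 + sqnorm y.
  have -> : s1 - s3 = (x ^t* *m (P - A *m P *m A ^t*) *m x) 0 0.
    by rewrite mulmxBr mulmxBl mxB00 s1E s3E.
  rewrite steinP mulmxBr mulmxBl mxB00 /u /y /sqnorm !adjmxM !trmxCK !mulmxA.
  by rewrite subrK.
have e5 : sqnorm (u - S *m y) = s1 - s3 + sqnorm y - t - t^* + sqnorm (S *m y).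
  rewrite -e4 {1}/sqnorm adjmxB mulmxBl !mulmxBr !mxB00 tC -tE /sqnorm.
  by ring.
have gE : g = s1 - z^-1 * q + a * (q^* - z^-1 * s3) - 2 * (t - sqnorm y).
  by rewrite /g e1 e2 -mulrA e3; ring.
have gC : g^* = s1 - a * q^* + z^-1 * (q - a * s3) - 2 * (t^* - sqnorm y).
  rewrite gE !(rmorphB, rmorphD, rmorphM, rmorph1) /= conjCK s1R s3R sqR acE.
  by rewrite fmorphV /= -aE.
rewrite e5 gC gE -s3E.
have [n1 n1E] : exists s, s = sqnorm y by eexists.
have [n2 n2E] : exists s, s = sqnorm (S *m y) by eexists.
rewrite -n1E -n2E; move: (z^-1) (q^*) (t^*) => zi q' t'.
by ring.
Qed.

End PickIdentity.

(** * Necessity *)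

Section Necessity.
Variable R : realType.
Local Notation C := R[i].
Local Notation normc := (@Normc.normc R).
#[local] Arguments Normc.normc : simpl never.

Lemma continuous_cM (f g : C -> C) z :
  {for z, continuous (f : C^o -> C^o)} -> {for z, continuous (g : C^o -> C^o)} ->
  {for z, continuous ((fun z => f z * g z) : C^o -> C^o)}.
Proof. by move=> fc gc; exact: (@continuousM C C^o f g z fc gc). Qed.

Lemma normc_sum (I : Type) (s : seq I) (f : I -> C) :
  normc (\sum_(j <- s) f j) <= \sum_(j <- s) normc (f j).
Proof.
elim: s => [|j s IH]; first by rewrite !big_nil Normc.normc0.
by rewrite !big_cons (le_trans (normcD _ _)) // lerD2l.
Qed.

Lemma resolventZ n (A : 'M[C]_n) c z : resolvent (c *: A) z = resolvent A (z * c).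
Proof. by rewrite /resolvent scalerA. Qed.

Lemma mulmx_bounded m n (M : 'M[C]_(m, n)) : exists2 c : R, 0 <= c &
  forall (b : R) (x : 'cV[C]_n), (forall j, normc (x j 0) <= b) -> 0 <= b ->
    forall i, normc ((M *m x) i 0) <= c * b.
Proof.
exists (\sum_i \sum_j normc (M i j)) => [|b x xb b0 i].
  by apply: sumr_ge0 => i _; apply: sumr_ge0 => j _; exact: normc_ge0.
rewrite mxE (le_trans (normc_sum _ _)) // (@le_trans _ _ (\sum_j normc (M i j) * b)) //.
  by apply: ler_sum => j _; rewrite normcM ler_wpM2l ?normc_ge0.
rewrite -mulr_suml ler_wpM2r // (bigD1 i) //= lerDl.
by apply: sumr_ge0 => i' _; apply: sumr_ge0 => j _; exact: normc_ge0.
Qed.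

Lemma normc_conj (x : C) : normc x^* = normc x.
Proof. by apply: (@complexI R); exact: norm_conjC. Qed.

Lemma quadform_bounded n (M : 'M[C]_n) : exists2 c : R, 0 <= c &
  forall (b : R) (x : 'cV[C]_n), (forall j, normc (x j 0) <= b) -> 0 <= b ->
    normc ((x ^t* *m M *m x) 0 0) <= c * b ^+ 2.
Proof.
have [c c0 H] := mulmx_bounded M.
exists (\sum_(i < n) c) => [|b x xb b0]; first by rewrite sumr_ge0.
rewrite -mulmxA mxE (le_trans (normc_sum _ _)) // mulr_suml; apply: ler_sum => j _.
rewrite normcM expr2 mulrCA; apply: ler_pM; rewrite ?normc_ge0 //.
  by rewrite mxE mxE normc_conj.
exact: H.
Qed.

Section Pick.
Variables (N k : nat) (A P : 'M[C]_N) (E F : 'M[C]_(N, k)).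
Variables (S : C -> 'M[C]_k) (K : C -> 'M[C]_(N, k)).
Hypothesis stableA : disk_stable A.
Hypothesis hermP : P ^t* = P.
Hypothesis steinP : P - A *m P *m A ^t* = E *m E ^t* - F *m F ^t*.
Hypothesis contrS : contractive_on_disk S.
Hypothesis interpK : forall z, disk z -> (z%:M - A) *m K z = E *m S z - F.

Let Psi (r : R) (z : C) : 'M[C]_N := resolvent (A ^t*) (z / (r ^+ 2)%:C).

(* On the circle of radius [r], [test v r z] has real part at least
   [- (r^-2 - 1) x^* A P A^* x] for [x := Psi r z *m v], and its value at [0] is
   [v^* P v]. *)
Let test (v : 'cV[C]_N) (r : R) (z : C) : C :=
  2 * (v ^t* *m P *m Psi r z *m v) 0 0 - (v ^t* *m P *m v) 0 0 -
  2 * z * (v ^t* *m K z *m F ^t* *m Psi r z *m v) 0 0.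

Lemma test_Re_ge (v : 'cV[C]_N) (r : R) (z : C) : 0 < r < 1 -> normc z = r ->
  1%:M - (z / (r ^+ 2)%:C) *: A ^t* \in unitmx ->
  forall x, x = Psi r z *m v ->
  - ((r ^- 2 - 1) * normc ((x ^t* *m (A *m P *m A ^t*) *m x) 0 0)) <=
  complex.Re (test v r z).
Proof.
move=> /andP[r0 r1] zr; set a := z / _ => unit x xE.
have z0 : z != 0 by apply: contraTneq r0 => z0; rewrite -zr z0 Normc.normc0 ltxx.
have dz : disk z by rewrite disk_normc zr.
have rr0 : (r ^+ 2)%:C != 0 :> C by rewrite fmorph_eq0 expf_neq0 // gt_eqF.
have zz : z * z^* = (r ^+ 2)%:C by rewrite -normCK normcE_norm zr rmorphXn.
have aE : a = (z^*)^-1.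
  apply: (mulIf rr0); rewrite /a divfK // -zz mulrCA mulVf ?mulr1 //.
  by rewrite conjC_eq0.
have vE : v = x - a *: (A ^t* *m x).
  rewrite xE /Psi -/a -[in LHS](mul1mx v) -(mul_resolvent unit).
  by rewrite -mulmxA mulmxBl mul1mx scalemxAl.
have key := pick_identity hermP steinP (interpK dz) z0 aE vE.
have xE' : v ^t* *m P *m x = v ^t* *m P *m Psi r z *m v by rewrite xE mulmxA.
have xE'' : v ^t* *m K z *m F ^t* *m x = v ^t* *m K z *m F ^t* *m Psi r z *m v.
  by rewrite xE mulmxA.
rewrite /= xE' xE'' -/(test v r z) in key.
pose s3 := (x ^t* *m (A *m P *m A ^t*) *m x) 0 0.
pose u := E ^t* *m x; pose y := F ^t* *m x.
have rhs0 : 0 <= 2 * sqnorm (u - S z *m y) + 2 * (sqnorm y - sqnorm (S z *m y)).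
  by rewrite addr_ge0 // mulr_ge0 ?sqnorm_ge0 // subr_ge0 contrS.
have rE : a * z^-1 - 1 = (r ^- 2 - 1)%:C.
  by rewrite /a mulrAC mulfV // mul1r rmorphB rmorph1 fmorphV.
move: rhs0; rewrite -key rE -/s3.
case: (test v r z) => tr ti; case: s3 => sr si; rewrite lecE /= => /andP[_].
rewrite ?mul0r ?mulr0 ?subr0 ?addr0 ?add0r ?oppr0 => H.
have : `|sr| <= normc (Complex sr si) := Re_le_normc (Complex sr si).
have r2 : 0 <= r ^- 2 - 1.
  by rewrite subr_ge0 -exprVn expr_ge1 // ?invr_ge0 ?(ltW r0) // invf_ge1 // ltW.
move/(ler_wpM2l r2); have := ler_norm ((r ^- 2 - 1) * sr).
by rewrite normrM (ger0_norm r2); lra.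
Qed.

Hypothesis holoK : forall i j, exists w, forall z, disk z ->
  {for z, continuous ((fun z => K z i j) : C^o -> C^o)} /\
  (z != w -> cderivable (fun z => K z i j) z).

Let test_mean_valued (v : 'cV[C]_N) (r : R) : 0 < r < 1 ->
  (forall z, normc z <= r -> 1%:M - (z / (r ^+ 2)%:C) *: A ^t* \in unitmx) ->
  mean_valued r (test v r).
Proof.
move=> /andP[r0 r1] unit; pose p := (v ^t* *m P *m v) 0 0.
have dPsi z : normc z <= r -> mxderivable (Psi r) z.
  move=> zr i j.
  rewrite (_ : (fun z => _) =
      (fun z => resolvent ((r ^+ 2)%:C^-1 *: A ^t*) z i j)).
    by apply: resolvent_derivable; rewrite scalerA; exact: unit.
  by apply/funext => w; rewrite resolventZ.
have dPv m (B : 'M[C]_(m, N)) z : normc z <= r ->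
    mxderivable (fun z => B *m (Psi r z *m v)) z.
  move=> zr; apply: mxderivableM; first exact: mxderivable_cst.
  by apply: mxderivableM; [exact: dPsi|exact: mxderivable_cst].
pose a z := 2 * (v ^t* *m P *m (Psi r z *m v)) 0 0 - p.
(* [K] enters entry by entry, so that each summand has at most one exceptional point. *)
pose h (ij : 'I_N * 'I_k) z := K z ij.1 ij.2 *
  (- 2 * (v ij.1 0)^* * (z * (F ^t* *m (Psi r z *m v)) ij.2 0)).
have -> : test v r = (fun z => a z + \sum_ij h ij z).
  apply/funext => z; rewrite /test /a -/p -!(mulmxA _ (Psi r z)); congr (_ + _).
  rewrite -(mulmxA _ (F ^t*)) mxE mulr_sumr -sumrN.
  under eq_bigr => j _ do rewrite mxE mulr_suml mulr_sumr -sumrN.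
  rewrite exchange_big pair_bigA /=; apply: eq_bigr => -[i j] _ /=.
  by rewrite /h /= [_ 0 i]mxE [_ 0 i]mxE; ring.
apply: mean_valuedD => //; last first.
  apply: mean_valued_sum => // -[i j].
  have [w Kw] := holoK i j.
  pose g z := - 2 * (v i 0)^* * (z * (F ^t* *m (Psi r z *m v)) j 0).
  have dg z : normc z <= r -> cderivable g z.
    move=> zr; apply: (cderivableM (cderivable_cst _ z)).
    exact: (cderivableM (cderivable_id z) (dPv _ (F ^t*) z zr j 0)).
  have dz z : normc z <= r -> disk z.
    by move=> zr; rewrite disk_normc (le_lt_trans zr).
  have ch z : normc z <= r -> {for z, continuous (h (i, j) : C^o -> C^o)}.
    move=> zr; have [cK _] := Kw z (dz z zr).
    exact: (continuous_cM cK (cderivable_continuous (dg z zr))).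
  split; first by move=> z zr; apply: ch; rewrite zr.
  have dh z : normc z <= r -> z != w -> derivable (h (i, j) : C^o -> C^o) z 1.
    move=> zr zw; apply/cderivableP; have [_ /(_ zw) dK] := Kw z (dz z zr).
    exact: (cderivableM dK (dg z zr)).
  exact: (circle_mean_value r0 ch dh).
have da z : normc z <= r -> cderivable a z.
  move=> zr; apply: (cderivableB _ (cderivable_cst p z)).
  exact: (cderivableM (cderivable_cst 2 z) (dPv _ (v ^t* *m P) z zr 0 0)).
split; first by move=> z zr; apply: cderivable_continuous; apply: da; rewrite zr.
(* [a] is derivable throughout; the exceptional point 0 is an arbitrary choice. *)
apply: (@circle_mean_value _ a 0) => // z zr.
  by apply: cderivable_continuous; exact: da.
by move=> _; apply/cderivableP; exact: da.
Qed.

Theorem pick_psd (v : 'cV[C]_N) : 0 <= (v ^t* *m P *m v) 0 0.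
Proof.
have [T T1 [M M0 HM]] := resolvent_bounded (disk_stable_adj stableA).
have [c c0 Hc] := quadform_bounded (A *m P *m A ^t*).
pose b := \sum_l M * normc (v l 0).
have b0 : 0 <= b by apply: sumr_ge0 => l _; rewrite mulr_ge0 ?normc_ge0.
set p := _ 0 0.
have pR : p^* = p.
  have -> : p^* = ((v ^t* *m P *m v) ^t*) 0 0 by rewrite [RHS]mxE mxE.
  by rewrite !adjmxM trmxCK hermP !mulmxA.
have -> : p = (complex.Re p)%:C by rewrite RRe_real //; apply/CrealP.
rewrite ler0c.
(* With [t = 1 / r] the error factor becomes [t^2 - 1]; [c] and [b] do not depend on [t], and
   [t <= T] keeps the resolvent within its uniform bound. *)
have key (t : R) : 1 < t -> t <= T -> - ((t ^+ 2 - 1) * (c * b ^+ 2)) <= complex.Re p.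
  move=> t1 tT; pose r := t^-1; have t0 : 0 < t := lt_trans ltr01 t1.
  have r01 : 0 < r < 1 by rewrite invr_gt0 t0 invf_lt1.
  have nr z : normc z <= r -> normc (z / (r ^+ 2)%:C) <= T.
    move=> zr; rewrite normcM normcV normc_real ger0_norm ?sqr_ge0 //.
    apply: (@le_trans _ _ (r / r ^+ 2)).
      by rewrite ler_wpM2r // invr_ge0 sqr_ge0.
    by rewrite expr2 invfM mulrA mulfV ?gt_eqF ?mul1r ?invrK //; case/andP: r01.
  have unit z : normc z <= r -> 1%:M - (z / (r ^+ 2)%:C) *: A ^t* \in unitmx.
    by move=> /nr /HM[].
  have e0 : test v r 0 = p.
    rewrite /test /Psi mul0r resolvent0 mulmx1 mulr0 mul0r subr0 -/p.
    by ring.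
  rewrite -e0; apply: mean_valued_ge (test_mean_valued v r01 unit) _.
    by case/andP: r01.
  move=> z zr; apply: le_trans (test_Re_ge r01 zr (unit z _) erefl); last by rewrite zr.
  have -> : r ^- 2 = t ^+ 2 by rewrite /r exprVn invrK.
  rewrite lerN2 ler_wpM2l ?subr_ge0 ?expr_ge1 ?(ltW t1) //; first exact: ltW.
  apply: Hc => // j; rewrite mxE (le_trans (normc_sum _ _)) // ler_sum // => l _.
  rewrite normcM ler_wpM2r ?normc_ge0 //.
  have zr' : normc z <= r by rewrite zr.
  by have [_ ->] := HM _ (nr z zr').
rewrite leNgt; apply/negP => p0.
pose B := c * b ^+ 2; have B0 : 0 <= B by rewrite mulr_ge0 ?sqr_ge0.
(* For [t = 1 + e] the error is [e (2 + e) B <= 3 e (B + 1) < 4 e (B + 1)], and the last bound on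
   [e] makes this at most minus the real part of [p]; [e <= T - 1] ensures [t <= T]. *)
pose e := Num.min 1 (Num.min (T - 1) (- complex.Re p / (4 * (B + 1)))).
have e4 : 0 < - complex.Re p / (4 * (B + 1)).
  by rewrite divr_gt0 ?oppr_gt0 // mulr_gt0 // ltr_wpDl.
have ep : 0 < e by rewrite !lt_min ltr01 subr_gt0 T1.
have [e1 e2 e3] : [/\ e <= 1, e <= T - 1 & e <= - complex.Re p / (4 * (B + 1))].
  by rewrite /e !ge_min !lexx !orbT.
have := key (1 + e); rewrite ltrDl ep => /(_ isT); rewrite -lerBrDl e2 => /(_ isT).
rewrite -/B; apply/negP; rewrite -ltNge ltrNr.
have -> : (1 + e) ^+ 2 - 1 = e * (2 + e) by ring.
apply: (@le_lt_trans _ _ (e * 3 * (B + 1))).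
  by rewrite ler_pM ?mulr_ge0 ?ler_pM2l ?lerDl //; lra.
apply: (@lt_le_trans _ _ (e * 4 * (B + 1))).
  by rewrite ltr_pM2r ?ltr_wpDl // ltr_pM2l // ltr_nat.
by rewrite -mulrA -ler_pdivlMr // mulr_gt0 // ltr_wpDl.
Qed.

End Pick.
End Necessity.

(** * Sufficiency *)

Lemma unitmx_inj (F : fieldType) n (A : 'M[F]_n) :
  (forall x : 'cV[F]_n, A *m x = 0 -> x = 0) -> A \in unitmx.
Proof.
move=> Ainj; rewrite -unitmx_tr -row_free_unit -kermx_eq0.
apply/eqP/row_matrixP => i; rewrite row0; set u := row i _.
have : u *m A^T = 0 by apply/sub_kermxP; exact: row_sub.
move/(congr1 trmx); rewrite trmx_mul trmxK trmx0 => /Ainj.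
by move/(congr1 trmx); rewrite trmxK trmx0.
Qed.

Section Realization.
Variable R : realType.
Local Notation C := R[i].

(* The lurking isometry: [P - A P A^* = E E^* - F F^*] with [P = L L^*] says that
   [AL E] and [L F] have the same Gram matrix, so a contraction [U] maps one to the
   other; [S] is the transfer function of [U]. *)
Theorem realization N k (A P : 'M[C]_N) (E F : 'M[C]_(N, k)) : psd P ->
  P - A *m P *m A ^t* = E *m E ^t* - F *m F ^t* ->
  exists S : C -> 'M[C]_k, exists K : C -> 'M[C]_(N, k),
    contractive_on_disk S /\ forall z, disk z ->
    [/\ mxderivable S z, mxderivable K z & (z%:M - A) *m K z = E *m S z - F].
Proof.
move=> [hP pP] steinP; have [L PE] := psd_factor hP pP.
have gram : row_mx (A *m L) E *m (row_mx (A *m L) E) ^t* =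
            row_mx L F *m (row_mx L F) ^t*.
  rewrite !tr_row_mx !map_col_mx !mul_row_col adjmxM mulmxA -(mulmxA A L) -PE.
  have /eqP := steinP; rewrite subr_eq => /eqP {2}->.
  by rewrite [RHS]addrAC subrK addrC.
have [U MU cU] := contraction_of_gram_eq gram.
pose a := ulsubmx U; pose b := ursubmx U; pose c := dlsubmx U; pose d := drsubmx U.
have UE : U = block_mx a b c d by rewrite submxK.
have [LE FE] : A *m L *m a + E *m c = L /\ A *m L *m b + E *m d = F.
  by move: MU; rewrite UE mul_row_block => /eq_row_mx.
(* [a] is a corner of the contraction [U], so [x = z a x] with [|z| < 1] forces [x = 0]. *)
have unit z : disk z -> 1%:M - z *: a \in unitmx.
  rewrite /disk /= => dz; apply: unitmx_inj => x.
  rewrite mulmxBl mul1mx -scalemxAl => /eqP; rewrite subr_eq0 => /eqP xE.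
  have : sqnorm (a *m x) <= sqnorm x.
    have := cU (col_mx x 0).
    rewrite UE mul_block_col !mulmx0 !addr0 !sqnorm_col_mx.
    rewrite [sqnorm 0](_ : _ = 0) ?addr0; last by apply/eqP; rewrite sqnorm_eq0.
    by apply: le_trans; rewrite lerDl sqnorm_ge0.
  move=> ax; apply/eqP; rewrite -sqnorm_eq0; apply/negPn/negP => x0.
  have sx : 0 < sqnorm x by rewrite lt_def x0 sqnorm_ge0.
  have : sqnorm x <= `|z| ^+ 2 * sqnorm x.
    by rewrite {1}xE sqnormZ ler_wpM2l // exprn_ge0.
  have z1 : `|z| ^+ 2 < 1 by rewrite expr_lt1.
  by rewrite ler_pMl // => /(lt_le_trans z1); rewrite ltxx.
(* [x] is the state of the system: with [y = x v], the matrix [U] sends the column (z y, v) to (y, S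
   v), and comparing norms gives the contractivity of [S]. *)
pose x z := resolvent a z *m b.
pose S z := d + z *: (c *m x z).
have xE z : disk z -> x z = z *: (a *m x z) + b.
  move=> dz; have := congr1 (mulmx^~ b) (mul_resolvent (unit z dz)).
  rewrite mul1mx -mulmxA -/(x z) mulmxBl mul1mx -scalemxAl => <-.
  by rewrite addrC subrK.
have dx z : disk z -> mxderivable x z.
  move=> dz; apply: mxderivableM; last exact: mxderivable_cst.
  by move=> i j; apply: resolvent_derivable; exact: unit.
exists S, (fun z => L *m x z); split=> [z dz v|z dz].
  pose y := x z *m v.
  have yE : a *m (z *: y) + b *m v = y.
    by rewrite /y [in RHS]xE // mulmxDl -scalemxAl -(mulmxA a) -scalemxAr.
  have := cU (col_mx (z *: y) v).
  rewrite UE mul_block_col yE !sqnorm_col_mx.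
  have -> : c *m (z *: y) + d *m v = S z *m v.
    by rewrite /S mulmxDl -scalemxAl -(mulmxA c) -/y -scalemxAr addrC.
  move=> H; rewrite -(lerD2l (sqnorm y)); apply: (le_trans H).
  rewrite lerD2r sqnormZ ler_piMl ?sqnorm_ge0 // expr_le1 //.
  by apply: ltW; exact: dz.
split.
- apply: mxderivableD; first exact: mxderivable_cst.
  apply: mxderivableZ; first exact: cderivable_id.
  by apply: mxderivableM; [exact: mxderivable_cst|exact: dx].
- by apply: mxderivableM; [exact: mxderivable_cst|exact: dx].
(* The two block columns of [[A L, E] U = [L, F]] eliminate [E c] and [F], leaving an identity in
   [L], [A] and [x]. *)
have cE : E *m c = L - A *m L *m a by rewrite -{1}LE addrC addKr.
have bE : b = x z - z *: (a *m x z) by rewrite {1}xE // addrC addKr.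
have -> : E *m S z - F = z *: (E *m c *m x z) - A *m L *m b.
  rewrite /S mulmxDr -scalemxAr (mulmxA E c) -FE.
  by rewrite [A *m L *m b + _]addrC opprD addrACA subrr add0r.
rewrite cE (mulmxBl L) scalerBr bE (mulmxBr (A *m L)) -scalemxAr (mulmxA (A *m L) a).
by rewrite opprB addrA subrK mulmxBl mul_scalar_mx (mulmxA A L).
Qed.

End Realization.

(** * Division by a Blaschke product *)

Section BlaschkeDivision.
Variable R : realType.
Local Notation C := R[i].
Local Notation normc := (@Normc.normc R).
#[local] Arguments Normc.normc : simpl never.

Definition bounded_on_disk (f : C -> C) : Prop :=
  exists M : R, forall z, disk z -> normc (f z) <= M.

Definition cholo (f : C -> C) : Prop := forall z, disk z -> cderivable f z.

Lemma HinftyP (f : C -> C) : Hinfty f <-> cholo f /\ bounded_on_disk f.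
Proof.
by split=> -[fd fb]; split => // z dz; [apply/cderivableP|apply/cderivableP]; exact: fd.
Qed.

Lemma bounded_on_diskM (f g : C -> C) :
  bounded_on_disk f -> bounded_on_disk g -> bounded_on_disk (fun z => f z * g z).
Proof.
move=> [M fM] [M' gM]; exists (M * M') => z dz; rewrite normcM.
by apply: ler_pM; rewrite ?normc_ge0 ?fM ?gM.
Qed.

Lemma bounded_on_disk_horner (p : {poly C}) : bounded_on_disk (horner p).
Proof.
have [M _ H] := horner_bounded p 1; exists M => z; rewrite disk_normc => /ltW.
exact: H.
Qed.

(* Division by [p] preserves boundedness: trivially away from the zeros of [p],
   and by continuity of the quotient near them. *)
Definition bounded_quotient (p : {poly C}) : Prop :=
  forall f g, bounded_on_disk f -> cholo g ->
    (forall z, disk z -> f z = p.[z] * g z) -> bounded_on_disk g.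

Lemma bounded_quotient1 : bounded_quotient 1.
Proof.
move=> f g [M fM] _ fg; exists M => z dz.
by have := fM z dz; rewrite fg // hornerC mul1r.
Qed.

Lemma bounded_quotientM p q :
  bounded_quotient p -> bounded_quotient q -> bounded_quotient (p * q).
Proof.
move=> Bp Bq f g fb gh fg; apply: (Bq (fun z => q.[z] * g z)) => //.
apply: (Bp f) => //; last by move=> z dz; rewrite fg // hornerM mulrA.
by move=> z dz; exact: (cderivableM (cderivable_horner q z) (gh z dz)).
Qed.

Lemma bounded_quotient_XsubC a : disk a -> bounded_quotient ('X - a%:P).
Proof.
move=> da f g [M fM] gh fg.
have [d d0 H] := ccont_bound (cderivable_continuous (gh a da)) ltr01.
exists (Num.max (1 + normc (g a)) (M / d)) => z dz.
rewrite le_max; have [zd|dlz] := leP (normc (z - a)) d; apply/orP; [left|right].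
  rewrite -lerBlDr; apply: le_trans (normc_distD _ _) _.
  exact: H.
rewrite ler_pdivlMr // mulrC; apply: le_trans (fM z dz).
by rewrite fg // hornerXsubC normcM ler_wpM2r ?normc_ge0 // ltW.
Qed.

Section Nodes.
Variables (m : nat) (lambda : 'I_m -> C) (r : 'I_m -> nat).
Hypothesis lambda_disk : forall j, disk (lambda j).
Hypothesis lambda_inj : injective lambda.

Let factor i : {poly C} := ('X - (lambda i)%:P) ^+ r i.

Let denominator : {poly C} := \prod_(i < m) (1 - ((lambda i)^* *: 'X)) ^+ r i.

Lemma blaschke_denominator_neq0 i z : disk z -> 1 - (lambda i)^* * z != 0.
Proof.
move=> dz; rewrite subr_eq0 eq_sym; apply/negP => /eqP e.
have : `|(lambda i)^* * z| < 1.
  have li : `|lambda i| < 1 := lambda_disk i; have zi : `|z| < 1 := dz.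
  by rewrite normrM norm_conjC mulr_ilt1.
by rewrite e normr1 ltxx.
Qed.

Lemma blaschkeE z : disk z ->
  blaschke lambda r z * denominator.[z] = (\prod_(i < m) factor i).[z].
Proof.
move=> dz; rewrite /blaschke !horner_prod -big_split /=; apply: eq_bigr => i _.
rewrite !horner_exp -exprMn hornerXsubC !hornerE.
by rewrite divfK // blaschke_denominator_neq0.
Qed.

(** Distinct nodes give coprime factors: if [u p + v q = 1], the two divisions [f = p g] and
    [f = q G] combine into [f = p q (u G + v g)], which is again analytic. *)
Lemma common_quotient (f : C -> C) (g : 'I_m -> C -> C) : cholo f ->
  (forall i, cholo (g i)) ->
  (forall i z, disk z -> f z = (z - lambda i) ^+ r i * g i z) ->
  exists2 G, cholo G & forall z, disk z -> f z = (\prod_(i < m) factor i).[z] * G z.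
Proof.
move=> fh gh fg; move: (index_enum _) (index_enum_uniq 'I_m) => s.
elim: s => [_|i s IH /= /andP[nis us]].
  by exists f => // z _; rewrite big_nil hornerC mul1r.
have [G Gh fG] := IH us.
have cop : coprimep (factor i) (\prod_(j <- s) factor j).
  rewrite coprimep_expl //; elim: s nis {us IH G Gh fG} => [|j s IH].
    by rewrite big_nil coprimep1.
  rewrite inE negb_or => /andP[ij /IH cs]; rewrite big_cons coprimepMr cs andbT.
  by rewrite coprimep_expr // coprimep_XsubC root_XsubC inj_eq // eq_sym.
have [[u v] /= uv] := Bezout_eq1_coprimepP _ _ cop.
exists (fun z => u.[z] * G z + v.[z] * g i z) => z dz.
  apply: (cderivableD (cderivableM (cderivable_horner u z) (Gh z dz))).
  exact: (cderivableM (cderivable_horner v z) (gh i z dz)).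
have fi : f z = (factor i).[z] * g i z by rewrite (fg i) // horner_exp hornerXsubC.
rewrite big_cons hornerM; set q := (\prod_(j <- s) factor j) in uv fG *.
have := congr1 (fun p => f z * p.[z]) uv; rewrite hornerD !hornerM hornerC mulr1 => <-.
rewrite mulrDr {1}fG // fi.
by ring.
Qed.

(** The denominator of the Blaschke product is a polynomial, hence bounded on the disk, so it is
    enough to divide by the numerator. *)
Lemma blaschke_division (f : C -> C) (g : 'I_m -> C -> C) : cholo f ->
  bounded_on_disk f -> (forall i, cholo (g i)) ->
  (forall i z, disk z -> f z = (z - lambda i) ^+ r i * g i z) ->
  exists2 h, Hinfty h & forall z, disk z -> f z = blaschke lambda r z * h z.
Proof.
move=> fh fb gh fg; have [G Gh fG] := common_quotient fh gh fg.
have Gb : bounded_on_disk G.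
  suff : bounded_quotient (\prod_(i < m) factor i) by apply; [exact: fb| |].
  apply: big_ind => [||i _]; [exact: bounded_quotient1|exact: bounded_quotientM|].
  rewrite /factor; elim: (r i) => [|n IH]; first exact: bounded_quotient1.
  by rewrite exprS; apply: bounded_quotientM IH; exact: bounded_quotient_XsubC.
exists (fun z => denominator.[z] * G z) => [|z dz].
  apply/HinftyP; split=> [z dz|].
    exact: (cderivableM (cderivable_horner denominator z) (Gh z dz)).
  exact: (bounded_on_diskM (bounded_on_disk_horner denominator) Gb).
by rewrite fG // mulrA blaschkeE.
Qed.

Lemma blaschke_multiple (h : C -> C) i : cholo h ->
  exists2 g, cholo g & forall z, disk z ->
    blaschke lambda r z * h z = (z - lambda i) ^+ r i * g z.
Proof.
move=> hh.
have db (j : 'I_m) z : disk z ->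
    cderivable (fun z => (1 - (lambda j)^* * z)^-1) z.
  move=> dz; apply: cderivableV; first exact: blaschke_denominator_neq0.
  apply: (cderivableB (cderivable_cst 1 z)).
  exact: (cderivableM (cderivable_cst _ z) (cderivable_id z)).
pose g z := (1 - (lambda i)^* * z)^-1 ^+ r i *
  (\prod_(j <- [seq j <- index_enum 'I_m | j != i])
     ((z - lambda j) / (1 - (lambda j)^* * z)) ^+ r j * h z).
exists g => z dz; last first.
  by rewrite /blaschke (bigD1 i) //= -big_filter exprMn /g !mulrA.
apply: (cderivableM (cderivableX _ (db i z dz))); apply: (cderivableM _ (hh z dz)).
apply: cderivable_prod => j; apply: cderivableX.
apply: (cderivableM _ (db j z dz)).
exact: (cderivableB (cderivable_id z) (cderivable_cst _ z)).
Qed.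

End Nodes.
End BlaschkeDivision.

(** * The extended Pick matrix *)

Section BlockAdjoint.
Variable C : numClosedFieldType.

Lemma mxcolZ m (p_ : 'I_m -> nat) q a (B : forall i, 'M[C]_(p_ i, q)) :
  a *: \mxcol_i B i = \mxcol_i (a *: B i).
Proof. by apply/matrixP => i j; rewrite !mxE. Qed.

Lemma mxrowZ m (p_ : 'I_m -> nat) q a (B : forall i, 'M[C]_(q, p_ i)) :
  a *: \mxrow_i B i = \mxrow_i (a *: B i).
Proof. by apply/matrixP => i j; rewrite !mxE. Qed.

Lemma mul_mxdiag m (p_ : 'I_m -> nat) (A B : forall i, 'M[C]_(p_ i)) :
  \mxdiag_i A i *m \mxdiag_i B i = \mxdiag_i (A i *m B i).
Proof.
rewrite [X in _ *m X]/mxdiag mul_mxdiag_mxblock; apply: eq_mxblock => i j.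
by case: eqP => [ij|_]; [case: _ / ij; rewrite !conform_mx_id | rewrite mulmx0].
Qed.

Lemma map_mxrow (aT rT : Type) (f : aT -> rT) m (p_ : 'I_m -> nat) q
    (B : forall i, 'M[aT]_(q, p_ i)) :
  map_mx f (\mxrow_i B i) = \mxrow_i map_mx f (B i).
Proof. by apply/matrixP => i j; rewrite !mxE. Qed.

Lemma map_mxblock (aT rT : Type) (f : aT -> rT) m n (p_ : 'I_m -> nat)
    (q_ : 'I_n -> nat) (B : forall i j, 'M[aT]_(p_ i, q_ j)) :
  map_mx f (\mxblock_(i, j) B i j) = \mxblock_(i, j) map_mx f (B i j).
Proof. by apply/matrixP => i j; rewrite !mxE. Qed.

Lemma adjmx_mxcol m (p_ : 'I_m -> nat) q (B : forall i, 'M[C]_(p_ i, q)) :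
  (\mxcol_i B i) ^t* = \mxrow_i (B i) ^t*.
Proof. by rewrite tr_mxcol map_mxrow. Qed.

Lemma adjmx_mxblock m n (p_ : 'I_m -> nat) (q_ : 'I_n -> nat)
    (B : forall i j, 'M[C]_(p_ i, q_ j)) :
  (\mxblock_(i, j) B i j) ^t* = \mxblock_(i, j) (B j i) ^t*.
Proof. by rewrite tr_mxblock map_mxblock. Qed.

Lemma adjmx_mxdiag m (p_ : 'I_m -> nat) (B : forall i, 'M[C]_(p_ i)) :
  (\mxdiag_i B i) ^t* = \mxdiag_i (B i) ^t*.
Proof.
rewrite tr_mxdiag /mxdiag map_mxblock; apply: eq_mxblock => i j.
by case: eqP => [->|_]; rewrite ?conform_mx_id // map_mx0.
Qed.

Lemma adjmx_block m1 m2 n1 n2 (A : 'M[C]_(m1, n1)) (B : 'M[C]_(m1, n2))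
    (D : 'M[C]_(m2, n1)) (E : 'M[C]_(m2, n2)) :
  (block_mx A B D E) ^t* = block_mx (A ^t*) (D ^t*) (B ^t*) (E ^t*).
Proof. by rewrite tr_block_mx map_block_mx. Qed.

Lemma adjmx_col m1 m2 n (A : 'M[C]_(m1, n)) (B : 'M[C]_(m2, n)) :
  (col_mx A B) ^t* = row_mx (A ^t*) (B ^t*).
Proof. by rewrite tr_col_mx map_row_mx. Qed.

Lemma adjmx_row m n1 n2 (A : 'M[C]_(m, n1)) (B : 'M[C]_(m, n2)) :
  (row_mx A B) ^t* = col_mx (A ^t*) (B ^t*).
Proof. by rewrite tr_row_mx map_col_mx. Qed.

(** Completes the square in [y]; the shift [w] vanishes exactly at [y = - Q c^* b]. *)
Lemma schur_complement_form N d (B : 'M[C]_N) (c : 'M[C]_(N, d)) (Q : 'M[C]_d)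
    (b : 'cV[C]_N) (y : 'cV[C]_d) : Q ^t* = Q -> Q \in unitmx ->
  let w := invmx Q *m y + c ^t* *m b in
  (col_mx b y) ^t* *m block_mx B c (c ^t*) (invmx Q) *m col_mx b y =
  b ^t* *m (B - c *m Q *m c ^t*) *m b + w ^t* *m Q *m w.
Proof.
move=> hQ uQ w; have hQi : (invmx Q) ^t* = invmx Q by rewrite trmx_inv map_invmx hQ.
have wE : w ^t* = y ^t* *m invmx Q + b ^t* *m c.
  by rewrite /w adjmxD !adjmxM hQi trmxCK.
have QwE : Q *m w = y + Q *m c ^t* *m b by rewrite mulmxDr mulKVmx // mulmxA.
have -> : w ^t* *m Q *m w = y ^t* *m invmx Q *m y + b ^t* *m c *m y +
    (y ^t* *m c ^t* *m b + b ^t* *m (c *m Q *m c ^t*) *m b).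
  rewrite -mulmxA QwE wE mulmxDl !mulmxDr !mulmxA mulmxKV //.
  by rewrite addrACA.
rewrite adjmx_col mul_row_block mul_row_col !mulmxDl mulmxBr mulmxBl.
rewrite [X in _ = _ + X]addrA [RHS]addrACA addNr addr0 -addrA; congr (_ + _).
by rewrite addrC [b ^t* *m c *m y + _]addrC.
Qed.

(* The Stein equation of the Pick matrix of the conditions [S = W] at [Z] and
   [S = X] at [J]. *)
Lemma extended_stein N d k (P Z W Y : 'M[C]_N) (J Q D : 'M[C]_d)
    (T : 'M[C]_(d, N)) (E : 'M[C]_(N, k)) (F : 'M[C]_(d, k)) (X : 'M[C]_k) :
  P - Z *m P *m Z ^t* = E *m E ^t* - (W *m E) *m (W *m E) ^t* ->
  Q - J *m Q *m J ^t* = F *m F ^t* -> T - J *m T *m Z ^t* = F *m E ^t* ->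
  E ^t* *m Y = X *m E ^t* -> Y *m W ^t* *m Z ^t* = Z ^t* *m (Y *m W ^t*) ->
  D *m F = F *m X -> D *m J = J *m D ->
  let G := T *m (1%:M - Y *m W ^t*) in
  let M := block_mx P (G ^t*) G (Q - D *m Q *m D ^t*) in
  let A := block_mx Z 0 0 J in
  M - A *m M *m A ^t* = col_mx E F *m (col_mx E F) ^t* -
    col_mx (W *m E) (F *m X) *m (col_mx (W *m E) (F *m X)) ^t*.
Proof.
move=> steinP steinQ steinT EY YWZ DF DJ G M A.
have stein21 : G - J *m G *m Z ^t* = F *m E ^t* - (F *m X) *m (W *m E) ^t*.
  (* [1 - Y W^*] commutes with [Z^*], so it passes through the Stein equation of [T]. *)
  have -> : J *m G *m Z ^t* = J *m T *m Z ^t* *m (1%:M - Y *m W ^t*).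
    rewrite /G -!mulmxA; do 2 congr (_ *m _).
    by rewrite mulmxBl mulmxBr mul1mx mulmx1 YWZ.
  rewrite /G -mulmxBl steinT mulmxBr mulmx1; congr (_ - _).
  by rewrite adjmxM -!mulmxA; congr (_ *m _); rewrite !mulmxA EY.
rewrite /M /A adjmx_block !adjmx0 !adjmx_col.
rewrite !mul_col_row !mulmx_block !(mul0mx, mulmx0, addr0, add0r).
rewrite !opp_block_mx !add_block_mx -steinP -stein21; congr block_mx.
  have := congr1 (fun M => M ^t*) stein21.
  by rewrite !adjmxB !adjmxM !trmxCK !mulmxA.
(* Since [D] commutes with [J], [D Q D^*] solves the Stein equation with right-hand side
   [D F F^* D^*], which is [F X X^* F^*] because [D F = F X]. *)
have JD : J ^t* *m D ^t* = D ^t* *m J ^t* by rewrite -!adjmxM DJ.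
have e : J *m (D *m Q *m D ^t*) *m J ^t* = D *m (J *m Q *m J ^t*) *m D ^t*.
  by rewrite !mulmxA -DJ -(mulmxA _ (D ^t*)) -JD mulmxA.
have -> : F *m X *m (F *m X) ^t* = D *m (F *m F ^t*) *m D ^t*.
  by rewrite -DF adjmxM !mulmxA.
rewrite mulmxBr mulmxBl e -steinQ.
rewrite mulmxBr mulmxBl !opprB addrACA [RHS]addrACA; congr (_ + _).
by rewrite addrC.
Qed.

End BlockAdjoint.

(** * Stability of the nodes and invertibility of [Q] *)

Section PickData.
Variable R : realType.
Local Notation C := R[i].
Variables (k n m : nat) (z : 'I_n -> C) (W : 'I_n -> 'M[C]_k).
Variables (lambda : 'I_m -> C) (r : 'I_m -> nat).
Hypothesis z_disk : forall i, disk (z i).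
Hypothesis lambda_disk : forall j, disk (lambda j).
Hypothesis lambda_inj : injective lambda.

Local Notation Z := (@Zmx R k n z).
Local Notation J := (@Jmx R k m lambda r).
Local Notation E := (@Emx R k n).
Local Notation Et := (@Etmx R k m r).
Local Notation Wt := (Wtmx W).
Local Notation Q := (@Qmx R k m lambda r).
Local Notation Qt := (@Qtmx R k n m z lambda r).

Lemma disk_neq1 (a b : C) : disk a -> `|b| <= 1 -> 1 - b * a != 0.
Proof.
rewrite /disk /= => da b1; rewrite subr_eq0 eq_sym; apply/negP => /eqP e.
have : `|b * a| < 1 by rewrite normrM (le_lt_trans _ da) // ler_piMl.
by rewrite e normr1 ltxx.
Qed.

Lemma mul_Zmx p (Y : forall i : 'I_n, 'M[C]_(k, p)) :
  Z *m \mxcol_i Y i = \mxcol_i (z i *: Y i).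
Proof.
by rewrite mul_mxdiag_mxcol; apply: eq_mxcol => i; rewrite mul_scalar_mx.
Qed.

(** The sum has at most one term, the block above [a], and none for [a = 0]; in this form no
    predecessor in ['I_(r i)] has to be named. *)
Lemma mul_Jmx p (Y : forall i, 'I_(r i) -> 'M[C]_(k, p)) :
  J *m \mxcol_i \mxcol_a Y i a =
  \mxcol_i \mxcol_a (lambda i *: Y i a + \sum_(b < r i | a == b.+1 :> nat) Y i b).
Proof.
rewrite mul_mxdiag_mxcol; apply: eq_mxcol => i.
rewrite mul_mxblock_mxrow; apply: eq_mxcol => a.
rewrite (bigD1 a) //= eqxx mul_scalar_mx; congr (_ + _).
rewrite [RHS]big_mkcond [RHS](bigD1 a) //= (ltn_eqF (ltnSn a)) add0r.
apply: eq_bigr => b ba; rewrite eq_sym (negPf ba).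
by case: eqP => _; rewrite ?mul1mx ?mul0mx.
Qed.

(** On rows the subdiagonal shifts the other way: the extra term is the block after [b], absent at
    the end of the chain. *)
Lemma mul_row_Jmx p (Y : forall i, 'I_(r i) -> 'M[C]_(p, k)) :
  (\mxrow_i \mxrow_a Y i a) *m J =
  \mxrow_i \mxrow_b (lambda i *: Y i b + \sum_(a < r i | a == b.+1 :> nat) Y i a).
Proof.
rewrite mul_mxrow_mxdiag; apply: eq_mxrow => i.
rewrite mul_mxrow_mxblock; apply: eq_mxrow => b.
rewrite (bigD1 b) //= eqxx mul_mx_scalar; congr (_ + _).
rewrite [RHS]big_mkcond [RHS](bigD1 b) //= (ltn_eqF (ltnSn b)) add0r.
apply: eq_bigr => a /negPf ->.
by case: eqP => _; rewrite ?mulmx1 ?mulmx0.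
Qed.

Lemma mxcol_Jordan p (Y : 'M[C]_(dimd k r, p)) :
  Y = \mxcol_i \mxcol_(a < r i) submxcol (submxcol Y i) a.
Proof. by rewrite -[LHS]submxcolK; apply: eq_mxcol => i; rewrite submxcolK. Qed.

Lemma mxrow_Jordan p (Y : 'M[C]_(p, dimd k r)) :
  Y = \mxrow_i \mxrow_(a < r i) submxrow (submxrow Y i) a.
Proof. by rewrite -[LHS]submxrowK; apply: eq_mxrow => i; rewrite submxrowK. Qed.

Lemma eq_mxcol_JordanP p (Y Y' : forall i, 'I_(r i) -> 'M[C]_(k, p)) :
  \mxcol_i \mxcol_a Y i a = \mxcol_i \mxcol_a Y' i a <-> forall i a, Y i a = Y' i a.
Proof.
split=> [/eq_mxcolP e i a|e]; first by have /eq_mxcolP := e i; apply.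
by apply: eq_mxcol => i; apply: eq_mxcol.
Qed.

Lemma scale_mxcol_Jordan p a (Y : forall i, 'I_(r i) -> 'M[C]_(k, p)) :
  a *: \mxcol_i \mxcol_b Y i b = \mxcol_i \mxcol_b (a *: Y i b).
Proof. by rewrite mxcolZ; apply: eq_mxcol => i; rewrite mxcolZ. Qed.

Lemma disk_stable_Zmx : disk_stable Z.
Proof.
move=> w w1; apply: unitmx_inj => x; rewrite -(submxcolK x).
set Y := submxcol x; rewrite mulmxBl mul1mx -scalemxAl mul_Zmx mxcolZ => /eqP.
rewrite subr_eq0 => /eqP/eq_mxcolP e; rewrite -(mxcol0 (p_ := fun=> k)); apply: eq_mxcol => i.
have : Y i = (w * z i) *: Y i.
  by rewrite {1}e scalerA.
move/eqP; rewrite -subr_eq0 -{1}[Y i]scale1r -scalerBl scaler_eq0.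
by rewrite (negPf (disk_neq1 (z_disk i) w1)) => /eqP.
Qed.

Lemma disk_stable_Jmx : disk_stable J.
Proof.
move=> w w1; apply: unitmx_inj => x; rewrite (mxcol_Jordan x).
set Y := fun i a => submxcol (submxcol x i) a.
rewrite -[\mxcol_i _]/(\mxcol_i \mxcol_a Y i a).
rewrite mulmxBl mul1mx -scalemxAl mul_Jmx scale_mxcol_Jordan => /eqP.
rewrite subr_eq0 => /eqP e.
have {}e i a : Y i a = w *: (lambda i *: Y i a + \sum_(b < r i | a == b.+1 :> nat) Y i b).
  by have := (eq_mxcol_JordanP _ _).1 e i a.
(* [J] is block lower triangular: each block is determined by the one above it, starting from the
   first, where the sum is empty. *)
have Y0 i (a : 'I_(r i)) : Y i a = 0.
  have [j] := ubnP a; elim: j a => // j IH a aj.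
  have := e i a; rewrite big1 ?addr0 => [|b /eqP ab]; last first.
    by apply: IH; rewrite -ltnS -ab.
  move/eqP; rewrite scalerA -subr_eq0 -{1}[Y i a]scale1r -scalerBl scaler_eq0.
  by rewrite (negPf (disk_neq1 (lambda_disk i) w1)) => /eqP.
rewrite -[RHS](mxcol0 (p_ := fun i => (\sum_(a < r i) k)%N)); apply: eq_mxcol => i.
by rewrite -[RHS](mxcol0 (p_ := fun=> k)); apply: eq_mxcol => a; exact: Y0.
Qed.

Lemma steinP p q (A : 'M[C]_p) (B : 'M[C]_q) (Y : 'M[C]_(p, q)) :
  disk_stable A -> disk_stable B -> stein A B Y - A *m stein A B Y *m B = Y.
Proof.
move=> sA sB; have [X XE] := stein_exists Y sA sB.
by rewrite /stein; apply: (@xgetPex _ 0 [set X | X - A *m X *m B = Y]); exists X.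
Qed.

Lemma QmxE : Q - J *m Q *m J ^t* = Et *m Et ^t*.
Proof. by apply: steinP; [|apply: disk_stable_adj]; exact: disk_stable_Jmx. Qed.

Lemma QtmxE : Qt - J *m Qt *m Z ^t* = Et *m E ^t*.
Proof.
apply: steinP; first exact: disk_stable_Jmx.
by apply: disk_stable_adj; exact: disk_stable_Zmx.
Qed.

Lemma Qmx_herm : Q ^t* = Q.
Proof.
have sJ := disk_stable_Jmx; apply: (stein_unique sJ (disk_stable_adj sJ)).
rewrite QmxE -[RHS](_ : (Et *m Et ^t*) ^t* = _); last by rewrite adjmxM trmxCK.
by rewrite -QmxE adjmxB !adjmxM trmxCK mulmxA.
Qed.

(** An instance of the necessity theorem with [S], [K] and [F] all zero, which spares the summation
    of the series for [Q]. *)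
Lemma Qmx_psd : psd Q.
Proof.
split=> [|v]; first exact: Qmx_herm.
apply: (@pick_psd R _ k J Q Et 0 (fun=> 0) (fun=> 0)).
- exact: disk_stable_Jmx.
- exact: Qmx_herm.
- by rewrite QmxE mul0mx subr0.
- by move=> w _ u; rewrite mul0mx [X in X <= _](_ : _ = 0) ?sqnorm_ge0 //;
    apply/eqP; rewrite sqnorm_eq0.
- by move=> w _; rewrite !mulmx0 subr0.
- move=> i j; exists 0 => w _.
  have d : cderivable (fun z => (fun=> 0 : 'M[C]_(dimd k r, k)) z i j) w.
    by rewrite /= mxE; exact: cderivable_cst.
  by split=> // ; exact: cderivable_continuous.
Qed.

(* Controllability of [(J, Et)]: it relies on the [lambda j] being distinct. *)
Lemma Jmx_eigenvector_eq0 (a : C) (u : 'rV[C]_(dimd k r)) :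
  u *m J = a *: u -> u *m Et = 0 -> u = 0.
Proof.
rewrite (mxrow_Jordan u); set Y := fun i b => submxrow (submxrow u i) b.
rewrite -[\mxrow_i _]/(\mxrow_i \mxrow_b Y i b) mul_row_Jmx => e uEt.
have {}e i b : (a - lambda i) *: Y i b = \sum_(c < r i | c == b.+1 :> nat) Y i c.
  move: e; rewrite mxrowZ => /eq_mxrowP/(_ i); rewrite mxrowZ => /eq_mxrowP/(_ b) e.
  by rewrite scalerBl -e addrC addKr.
(* When [a] differs from [lambda i], the blocks vanish one after another from the last. *)
have Y0 i (b : 'I_(r i)) : a != lambda i -> Y i b = 0.
  move=> ai; have [j] := ubnP (r i - b)%N; elim: j b => // j IH b bj.
  have := e i b; rewrite big1 => [/eqP|c /eqP cb].
    by rewrite scaler_eq0 subr_eq0 (negPf ai) => /eqP.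
  by apply: IH; rewrite cb; have := ltn_ord c; rewrite cb; lia.
(* When [a = lambda i], the equation at the preceding index says that block [c] is zero, so only the
   first block can survive. *)
have Y1 i (c : 'I_(r i)) : c != 0%N :> nat -> Y i c = 0.
  move=> c0; have [ai|/Y0 //] := eqVneq a (lambda i).
  have bP : (c.-1 < r i)%N by have := ltn_ord c; lia.
  have := e i (Ordinal bP); rewrite ai subrr scale0r (big_pred1 c) // => b /=.
  by rewrite prednK ?lt0n //.
(* [u Et] is the sum of the first blocks, and at most one of them is nonzero since at most one
   [lambda i] equals [a]. *)
have Y2 : \sum_i \sum_(b < r i | b == 0%N :> nat) Y i b = 0.
  rewrite -[RHS]uEt mul_mxrow_mxcol; apply: eq_bigr => i _.
  rewrite mul_mxrow_mxcol big_mkcond; apply: eq_bigr => b _.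
  by case: eqP => _; rewrite ?mulmx1 ?mulmx0.
have Y3 i b : Y i b = 0.
  have [b0|/Y1 //] := eqVneq (b : nat) 0%N.
  have [ai|/Y0 //] := eqVneq a (lambda i).
  rewrite -[RHS]Y2 (bigD1 i) //= [X in _ + X]big1 ?addr0 => [|j ji].
    by rewrite (big_pred1 b) // => c /=; rewrite -b0.
  by rewrite big1 // => c _; apply: Y0; rewrite ai inj_eq // eq_sym.
rewrite -[RHS](mxrow0 (q_ := fun i => (\sum_(a < r i) k)%N)); apply: eq_mxrow => i.
by rewrite -[RHS](mxrow0 (q_ := fun=> k)); apply: eq_mxrow => b; exact: Y3.
Qed.

(* The left kernel of [Q = J Q J^* + Et Et^*] is invariant under [J] and annihilated
   by [Et]; an eigenvector of [J] in it would contradict controllability. *)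
Lemma Qmx_unit : Q \in unitmx.
Proof.
have [hQ pQ] := Qmx_psd; have [L QE] := psd_factor hQ pQ.
rewrite -row_free_unit -kermx_eq0; apply: contrapT => /negP V0.
have [V VQ VE] : exists2 V, V *m Q = 0 & V = kermx Q.
  by exists (kermx Q); first exact: mulmx_ker.
rewrite -VE in V0.
(* [V Q V^* = 0] is the sum of the Gram matrices of [V J L] and [V Et], so both vanish. *)
have : row_mx (V *m J *m L) (V *m Et) = 0.
  apply: mul_adjmx_eq0; rewrite adjmx_row mul_row_col !adjmxM !mulmxA.
  rewrite -(mulmxA _ L (L ^t*)) -QE -(mulmxA V J) -(mulmxA V (J *m Q)) -(mulmxA V Et).
  by rewrite -mulmxDl -mulmxDr -QmxE [X in V *m X]addrC subrK VQ mul0mx.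
rewrite -row_mx0 => /eq_row_mx[VJL VEt].
have VJ : (row_base V *m J <= row_base V)%MS.
  rewrite (eqmxMr J (eq_row_base V)) eq_row_base VE; apply/sub_kermxP; rewrite -VE.
  by rewrite QE mulmxA VJL mul0mx.
(* [M] represents [J] on the row space of [V]; as that space is nonzero, [M] has an eigenvector,
   which [row_base V] carries to one of [J]. *)
have /submxP[M ME] := VJ.
have rk : (0 < \rank V)%N by rewrite lt0n mxrank_eq0.
have [a /eigenvalueP[w wM w0]] := eigenvalue_closed M rk.
have : w *m row_base V = 0.
  apply: (@Jmx_eigenvector_eq0 a); first by rewrite -mulmxA ME mulmxA wM scalemxAl.
  have /submxP[D ->] : (w *m row_base V <= V)%MS.
    by apply: (submx_trans (submxMl _ _)); rewrite eq_row_base.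
  by rewrite -mulmxA VEt mulmx0.
by move/eqP; rewrite mulmx_free_eq0 ?row_base_free // (negPf w0).
Qed.

End PickData.

(** * Reduction of [PX] to the Pick matrix of an interpolation problem *)

Section ExtendedPick.
Variable R : realType.
Local Notation C := R[i].

Lemma psd_schur_complement N d (B : 'M[C]_N) (c : 'M[C]_(N, d)) (Q : 'M[C]_d) :
  psd Q -> Q \in unitmx ->
  psd (block_mx B c (c ^t*) (invmx Q)) <-> psd (B - c *m Q *m c ^t*).
Proof.
move=> [hQ pQ] uQ; have hc : (c *m Q *m c ^t*) ^t* = c *m Q *m c ^t*.
  by rewrite !adjmxM trmxCK hQ mulmxA.
split=> -[hB pB]; split=> [|v].
- move: hB; rewrite adjmx_block trmxCK => /eq_block_mx[hB _ _ _].
  by rewrite adjmxB hc hB.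
(* This choice of the lower component makes the completed square vanish. *)
- have := pB (col_mx v (- (Q *m c ^t* *m v))).
  rewrite schur_complement_form // mulmxN !mulmxA mulVmx // mul1mx addNr.
  by rewrite mulmx0 addr0.
- have {}hB : B ^t* = B by have := hB; rewrite adjmxB hc => /addIr.
  by rewrite adjmx_block trmxCK hB trmx_inv map_invmx hQ.
- rewrite -(vsubmxK v) schur_complement_form // mxE addr_ge0 //; exact: pB.
Qed.

Variables (k n m : nat) (z : 'I_n -> C) (W : 'I_n -> 'M[C]_k).
Variables (lambda : 'I_m -> C) (r : 'I_m -> nat) (X : 'M[C]_k).
Hypothesis z_disk : forall i, disk (z i).
Hypothesis lambda_disk : forall j, disk (lambda j).
Hypothesis lambda_inj : injective lambda.

Local Notation P := (Defs.pickP z W).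
Local Notation Z := (@Zmx R k n z).
Local Notation J := (@Jmx R k m lambda r).
Local Notation E := (@Emx R k n).
Local Notation Et := (@Etmx R k m r).
Local Notation Wt := (Wtmx W).
Local Notation Q := (@Qmx R k m lambda r).
Local Notation Qt := (@Qtmx R k n m z lambda r).
Local Notation Xn := (@Xn R k n X).
Local Notation Xd := (@Xd R k m r X).

Let G := Qt *m (1%:M - Xn *m Wt ^t*).

Definition node_mx : 'M[C]_(dimn k n + dimd k r) := block_mx Z 0 0 J.
Definition direction_mx : 'M[C]_(dimn k n + dimd k r, k) := col_mx E Et.
Definition value_mx : 'M[C]_(dimn k n + dimd k r, k) := col_mx (Wt *m E) (Et *m X).

(* The Pick matrix of the interpolation problem [S (z i) = W i] together with
   [S = X] modulo the Blaschke product. *)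
Definition extended_pick : 'M[C]_(dimn k n + dimd k r) :=
  block_mx P (G ^t*) G (Q - Xd *m Q *m Xd ^t*).

Lemma node_mx_stable : disk_stable node_mx.
Proof.
move=> w w1; have uZ := @disk_stable_Zmx R k n z z_disk w w1.
have uJ := @disk_stable_Jmx R k m lambda r lambda_disk w w1.
rewrite /node_mx (scalar_mx_block _ _ 1) scale_block_mx !scaler0.
rewrite opp_block_mx add_block_mx !oppr0 !addr0.
by rewrite unitmxE det_ublock unitrM -!unitmxE uZ.
Qed.

Lemma WtE : Wt *m E = \mxcol_i W i.
Proof. by rewrite mul_mxdiag_mxcol; apply: eq_mxcol => i; rewrite mulmx1. Qed.

Lemma XdEt : Xd *m Et = Et *m X.
Proof.
rewrite mul_mxdiag_mxcol mxcol_mul; apply: eq_mxcol => i.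
rewrite mul_mxdiag_mxcol mxcol_mul; apply: eq_mxcol => a.
by case: eqP => _; rewrite ?mulmx1 ?mul1mx ?mulmx0 ?mul0mx.
Qed.

Lemma XdJ : Xd *m J = J *m Xd.
Proof.
rewrite !mul_mxdiag; apply: eq_mxdiag => i.
rewrite mul_mxdiag_mxblock mul_mxblock_mxdiag.
apply: eq_mxblock => a b; case: eqP => _; first by rewrite scalar_mxC.
by case: eqP => _; rewrite ?mulmx1 ?mul1mx ?mulmx0 ?mul0mx.
Qed.

Lemma pickPE : P - Z *m P *m Z ^t* = E *m E ^t* - (Wt *m E) *m (Wt *m E) ^t*.
Proof.
rewrite WtE adjmx_mxdiag !adjmx_mxcol !mul_mxcol_mxrow.
rewrite mul_mxdiag_mxblock mul_mxblock_mxdiag -!mxblockB; apply: eq_mxblock => i j.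
rewrite adjmx1 mulmx1 adjmx_scalar mul_scalar_mx mul_mx_scalar !scalerA.
rewrite -scalerBl -[RHS]scale1r; congr (_ *: _).
rewrite [_^* * _]mulrC -[X in X - _ = _]mul1r -mulrBl mulfV //.
by rewrite mulrC disk_neq1 // norm_conjC ltW //; exact: z_disk.
Qed.

Lemma XnE : E ^t* *m Xn = X *m E ^t*.
Proof.
rewrite adjmx_mxcol mul_mxrow_mxdiag mul_mxrow; apply: eq_mxrow => i.
by rewrite adjmx1 mul1mx mulmx1.
Qed.

Lemma XnWtZ : Xn *m Wt ^t* *m Z ^t* = Z ^t* *m (Xn *m Wt ^t*).
Proof.
have -> : Z ^t* = \mxdiag_(i < n) (((z i)^*)%:M : 'M[C]_k).
  by rewrite adjmx_mxdiag; apply: eq_mxdiag => i; rewrite adjmx_scalar.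
rewrite adjmx_mxdiag !mul_mxdiag.
by apply: eq_mxdiag => i; rewrite scalar_mxC.
Qed.

Lemma extended_pick_herm : extended_pick ^t* = extended_pick.
Proof.
have hQ := @Qmx_herm R k m lambda r lambda_disk.
rewrite /extended_pick adjmx_block trmxCK adjmxB; congr block_mx.
  rewrite /Defs.pickP adjmx_mxblock; apply: eq_mxblock => i j.
  rewrite adjmxZ adjmxB adjmx1 adjmxM trmxCK; congr (_ *: _).
  by rewrite fmorphV rmorphB rmorph1 rmorphM /= conjCK mulrC.
by rewrite hQ !adjmxM trmxCK hQ mulmxA.
Qed.

Lemma extended_pickE :
  extended_pick - node_mx *m extended_pick *m node_mx ^t* =
  direction_mx *m direction_mx ^t* - value_mx *m value_mx ^t*.
Proof.
exact: (extended_stein pickPE (QmxE k r lambda_disk)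
  (QtmxE k r z_disk lambda_disk) XnE XnWtZ XdEt XdJ).
Qed.

Lemma PX_psd : psd (PX z W lambda r X) <-> psd extended_pick.
Proof.
have hQ := @Qmx_psd R k m lambda r lambda_disk.
have uQ := @Qmx_unit R k m lambda r lambda_disk lambda_inj.
have -> : PX z W lambda r X = block_mx
    (block_mx P ((1%:M - Wt *m Xn ^t*) *m Qt ^t*) G Q)
    (col_mx 0 Xd) ((col_mx 0 Xd) ^t*) (invmx Q).
  by rewrite adjmx_col adjmx0.
apply: iff_trans (psd_schur_complement _ _ hQ uQ) _.
rewrite (_ : _ - _ = extended_pick) // adjmx_col adjmx0 mul_col_mx mul0mx.
rewrite mul_col_row !mul0mx mulmx0 opp_block_mx add_block_mx !oppr0 !addr0.
by rewrite /extended_pick /G adjmxM adjmxB adjmx1 adjmxM trmxCK.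
Qed.

End ExtendedPick.

(** * Interpolation *)

Section Interpolation.
Variable R : realType.
Local Notation C := R[i].
Local Notation normc := (@Normc.normc R).
#[local] Arguments Normc.normc : simpl never.

Lemma cholo_eq (f g : C -> C) : (forall z, disk z -> f z = g z) -> cholo f -> cholo g.
Proof.
move=> fg fh z dz; have z1 : 0 < 1 - normc z by rewrite subr_gt0 -disk_normc.
apply: (cderivable_near z1) (fh z dz) => w wz; apply: fg.
rewrite disk_normc -(subrK z w) (le_lt_trans (normcD _ _)) //.
by rewrite -ltrBrDr.
Qed.

(** At [w] the quotient takes the derivative as its value and only continuity is claimed, which is
    what [circle_mean_value] asks at its exceptional point. *)
Lemma difference_quotient (f : C -> C) (w : C) : cholo f -> disk w ->
  exists q : C -> C, (forall z, (z - w) * q z = f z - f w) /\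
    forall z, disk z -> {for z, continuous (q : C^o -> C^o)} /\
      (z != w -> cderivable q z).
Proof.
move=> fh dw; have /cderivableP/cdiff_bound[c Hc] := fh w dw.
pose q z := if z == w then c else (f z - f w) / (z - w).
have qE z : (z - w) * q z = f z - f w.
  rewrite /q; case: eqVneq => [->|zw]; first by rewrite !subrr mul0r.
  by rewrite mulrCA mulfV ?mulr1 // subr_eq0.
have dq z : disk z -> z != w -> cderivable q z.
  move=> dz zw; have d0 : 0 < normc (z - w).
    rewrite lt_def normc_ge0 andbT; apply: contra zw => /eqP/Normc.eq0_normc/eqP.
    by rewrite subr_eq0.
  apply: (@cderivable_near _ (fun z => (f z - f w) / (z - w)) q z _ d0).
    move=> y yz; rewrite /q; case: eqP => // yw.
    by move: yz; rewrite yw normc_distC ltxx.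
  apply: (cderivableM (cderivableB (fh z dz) (cderivable_cst _ z))).
  apply: cderivableV; first by rewrite subr_eq0.
  exact: (cderivableB (cderivable_id z) (cderivable_cst _ z)).
exists q; split=> // z dz; split; last exact: dq.
have [->|zw] := eqVneq z w; last exact: cderivable_continuous (dq z dz zw).
apply/(@cvgrPdist_le C C^o C^o _ (nbhs_filter (w : C^o))) => e /gt0_complex_real[-> e0].
have [d d0 H] := Hc _ e0; have d0' : 0 < d%:C by rewrite ltcR.
apply/nbhs_ballP; exists d%:C => //= y; rewrite /ball /= distrC normcE_norm ltcR => yd.
have qw : q w = c by rewrite /q eqxx.
have [->|yw] := eqVneq y w; first by rewrite subrr normr0 lecR ltW.
rewrite qw distrC normcE_norm lecR.
have n0 : 0 < normc (y - w).
  rewrite lt_def normc_ge0 andbT; apply: contra yw => /eqP/Normc.eq0_normc/eqP.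
  by rewrite subr_eq0.
rewrite -(ler_pM2r n0) -normcM mulrBl [q y * _]mulrC qE.
by apply: H; exact: ltW.
Qed.

Lemma contractive_entry_bounded k (S : C -> 'M[C]_k) a b :
  contractive_on_disk S -> bounded_on_disk (fun z => S z a b).
Proof.
move=> cS; exists 1 => z dz.
have := cS z dz (delta_mx b 0).
have -> : sqnorm (delta_mx b 0 : 'cV[C]_k) = 1.
  rewrite sqnormE (bigD1 b) //= big1 => [|j jb]; first by rewrite mxE !eqxx normr1 expr1n addr0.
  by rewrite mxE (negPf jb) normr0 expr0n.
rewrite -colE sqnormE (bigD1 a) //= mxE => H.
have : `|S z a b| ^+ 2 <= 1.
  by apply: le_trans H; rewrite lerDl sumr_ge0 // => i _; rewrite exprn_ge0.
rewrite normcE_norm -rmorphXn -[1]/((1 : R)%:C) lecR => h.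
by rewrite -(expr_le1 (n := 2)) ?normc_ge0.
Qed.

Variables (k n m : nat) (z : 'I_n -> C) (W : 'I_n -> 'M[C]_k).
Variables (lambda : 'I_m -> C) (r : 'I_m -> nat).
Hypothesis z_disk : forall i, disk (z i).
Hypothesis lambda_disk : forall j, disk (lambda j).
Hypothesis lambda_inj : injective lambda.
Hypothesis r_ge1 : forall j, (1 <= r j)%N.

(** With [targetE], this spells out the interpolation equation: [(w - z i) Y1 i = S - W i], and at
    [lambda i] a chain starting from [S - X] in which each term is [w - lambda i] times the next. *)
Let chainK (w : C) (Y1 : 'I_n -> 'M[C]_k) (Y2 : forall i, 'I_(r i) -> 'M[C]_k) :
  (w%:M - node_mx k z lambda r) *m
    col_mx (\mxcol_(i < n) Y1 i) (\mxcol_i \mxcol_a Y2 i a) =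
  col_mx (\mxcol_i ((w - z i) *: Y1 i))
    (\mxcol_i \mxcol_a ((w - lambda i) *: Y2 i a -
      \sum_(b < r i | a == b.+1 :> nat) Y2 i b)).
Proof.
rewrite mulmxBl mul_scalar_mx /node_mx mul_block_col !mul0mx addr0 add0r.
rewrite scale_col_mx mul_Zmx mul_Jmx mxcolZ scale_mxcol_Jordan.
rewrite opp_col_mx add_col_mx; congr col_mx.
  by rewrite -mxcolB; apply: eq_mxcol => i; rewrite scalerBl.
rewrite -mxcolB; apply: eq_mxcol => i; rewrite -mxcolB; apply: eq_mxcol => a.
by rewrite scalerBl opprD addrA.
Qed.

Let targetE (S X : 'M[C]_k) :
  direction_mx R k n r *m S - value_mx W r X =
  col_mx (\mxcol_i (S - W i))
    (\mxcol_i \mxcol_(a < r i) (if a == 0%N :> nat then S - X else 0)).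
Proof.
rewrite /direction_mx /value_mx mul_col_mx WtE opp_col_mx add_col_mx; congr col_mx.
  by rewrite mxcol_mul -mxcolB; apply: eq_mxcol => i; rewrite mul1mx.
rewrite !mxcol_mul -mxcolB; apply: eq_mxcol => i.
rewrite !mxcol_mul -mxcolB; apply: eq_mxcol => a.
by case: eqP => _; rewrite ?mul1mx ?mul0mx ?subr0.
Qed.

Lemma interpolant_pick_psd (S : C -> 'M[C]_k) : schurB (blaschke lambda r) S ->
  (forall i, S (z i) = W i) -> exists X, psd (PX z W lambda r X).
Proof.
move=> [SB /supnorm_le1 cS] SW.
have [X XP] : exists X : 'M[C]_k, forall a b, exists2 h, cholo h &
    forall w, disk w -> S w a b = X a b + blaschke lambda r w * h w.
  have [c cP] := choice (fun ab : 'I_k * 'I_k => SB ab.1 ab.2).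
  exists (\matrix_(a, b) c (a, b)) => a b; have [h hH SE] := cP (a, b).
  by exists h => [|w dw]; [case/HinftyP: hH|rewrite mxE SE].
have Sh a b : cholo (fun w => S w a b).
  have [h hh SE] := XP a b.
  apply: (@cholo_eq (fun w => X a b + blaschke lambda r w * h w)).
    by move=> w dw; rewrite SE.
  case: (pselect (exists i : 'I_m, True)) => [[i _]|no].
    have [g gh gE] := blaschke_multiple r lambda_disk i hh.
    apply: (@cholo_eq (fun w => X a b + (w - lambda i) ^+ r i * g w)) => [w dw|w dw].
      by rewrite gE.
    apply: (cderivableD (cderivable_cst _ w)); apply: (cderivableM _ (gh w dw)).
    apply: cderivableX; exact: (cderivableB (cderivable_id w) (cderivable_cst _ w)).
  apply: (@cholo_eq (fun w => X a b + h w)) => [w dw|w dw].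
    rewrite /blaschke big1 ?mul1r // => i _; case: no; by exists i.
  exact: (cderivableD (cderivable_cst _ w) (hh w dw)).
exists X; apply/(@PX_psd R k n m z W lambda r X lambda_disk lambda_inj).
have qex (iab : 'I_n * 'I_k * 'I_k) : exists q : C -> C,
    (forall w, (w - z iab.1.1) * q w = S w iab.1.2 iab.2 - W iab.1.1 iab.1.2 iab.2) /\
    forall w, disk w -> {for w, continuous (q : C^o -> C^o)} /\
      (w != z iab.1.1 -> cderivable q w).
  case: iab => -[i a] b /=; rewrite -SW.
  exact: (difference_quotient (Sh a b) (z_disk i)).
have gex (iab : 'I_m * 'I_k * 'I_k) : exists g : C -> C, cholo g /\
    forall w, disk w -> S w iab.1.2 iab.2 - X iab.1.2 iab.2 =
      (w - lambda iab.1.1) ^+ r iab.1.1 * g w.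
  case: iab => -[i a] b /=; have [h hh SE] := XP a b.
  have [g gh gE] := blaschke_multiple r lambda_disk i hh.
  by exists g; split=> // w dw; rewrite SE // addrAC subrr add0r gE.
have [q qP] := choice qex; have [g gP] := choice gex.
pose Y1 w i : 'M[C]_k := \matrix_(a, b) q (i, a, b) w.
(* This is [S - X] divided by the power [a + 1] of [w - lambda i], written without division; at the
   last block the exponent is 0 and [g] remains. *)
pose Y2 w i (a : 'I_(r i)) : 'M[C]_k :=
  (w - lambda i) ^+ (r i - a.+1) *: \matrix_(c, d) g (i, c, d) w.
pose K w := col_mx (\mxcol_(i < n) Y1 w i) (\mxcol_i \mxcol_a Y2 w i a).
have hP := @extended_pick_herm R k n m z W lambda r X lambda_disk.
split=> // v.
apply: (@pick_psd R _ k (node_mx k z lambda r) _ (direction_mx R k n r)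
  (value_mx W r X) S K).
- exact: node_mx_stable.
- by [].
- exact: extended_pickE.
- exact: cS.
- move=> w dw; rewrite chainK targetE; congr col_mx.
    apply: eq_mxcol => i; apply/matrixP => a b; rewrite !mxE.
    by have [-> _] := qP (i, a, b).
  apply/eq_mxcol_JordanP => i a.
  have [a0|a0] := eqVneq (a : nat) 0%N.
    rewrite big1 ?subr0 => [|b /eqP]; last by rewrite a0.
    rewrite /Y2 a0 scalerA -exprS subn1 prednK //.
    by apply/matrixP => c d; rewrite !mxE; have [_ ->] := gP (i, c, d).
  have bP : (a.-1 < r i)%N by have := ltn_ord a; lia.
  rewrite (big_pred1 (Ordinal bP)) => [|b]; last first.
    by rewrite /= -val_eqE /=; lia.
  rewrite /Y2 scalerA -exprS /=; apply/eqP; rewrite subr_eq0; apply/eqP.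
  by congr (_ ^+ _ *: _); have := ltn_ord a; lia.
move=> I j; case: (split_ordP I) => [I1 ->|I2 ->].
  (* An upper row of [K] belongs to a single node [z i], the only point where its difference
     quotients may fail to be derivable. *)
  exists (z (tagnat.sig1 I1)) => w dw.
  rewrite (_ : (fun w => _) = q (tagnat.sig1 I1, tagnat.sig2 I1, j)).
    by have [_] := qP (tagnat.sig1 I1, tagnat.sig2 I1, j); apply.
  by apply/funext => y; rewrite /K col_mxEu !mxE.
(* The rows at the [lambda i] are derivable on the whole disk; the point 0 is arbitrary. *)
exists 0 => w dw; set i := tagnat.sig1 I2; set t := tagnat.sig2 I2.
suff d : cderivable (fun w => K w (rshift _ I2) j) w.
  by split=> // ; exact: cderivable_continuous.
rewrite (_ : (fun w => _) = (fun w => (w - lambda i) ^+ (r i - (tagnat.sig1 t).+1) *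
    g (i, tagnat.sig2 t, j) w)).
  have [gh _] := gP (i, tagnat.sig2 t, j); apply: (cderivableM _ (gh w dw)).
  apply: cderivableX; exact: (cderivableB (cderivable_id w) (cderivable_cst _ w)).
by apply/funext => y; rewrite /K col_mxEd !mxE.
Qed.

Lemma pick_psd_interpolant (X : 'M[C]_k) : psd (PX z W lambda r X) ->
  exists2 S : C -> 'M[C]_k, schurB (blaschke lambda r) S & forall i, S (z i) = W i.
Proof.
move=> /(@PX_psd R k n m z W lambda r X lambda_disk lambda_inj) pM.
have [S [K [cS SK]]] := realization pM (@extended_pickE R k n m z W lambda r X z_disk lambda_disk).
pose Y1 w i := submxcol (usubmx (K w)) i : 'M[C]_k.
pose Y2 w i (a : 'I_(r i)) := submxcol (submxcol (dsubmx (K w)) i) a : 'M[C]_k.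
have KE w : K w = col_mx (\mxcol_(i < n) Y1 w i) (\mxcol_i \mxcol_a Y2 w i a).
  by rewrite -[LHS]vsubmxK [dsubmx _ in LHS]mxcol_Jordan submxcolK.
have key w : disk w -> (forall i, (w - z i) *: Y1 w i = S w - W i) /\
    (forall i a, (w - lambda i) *: Y2 w i a -
      \sum_(b < r i | a == b.+1 :> nat) Y2 w i b =
      if a == 0%N :> nat then S w - X else 0).
  move=> dw; have [_ _] := SK w dw; rewrite KE chainK targetE.
  by move=> /eq_col_mx[/eq_mxcolP e1 /eq_mxcol_JordanP e2].
exists S => [|i]; last first.
  have [/(_ i) + _] := key _ (z_disk i); rewrite subrr scale0r => /esym/eqP.
  by rewrite subr_eq0 => /eqP.
split; last by apply/supnorm_le1.
move=> a b; exists (X a b).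
have dS : cholo (fun w => S w a b) by move=> w dw; have [/(_ a b)] := SK w dw.
pose f w := S w a b - X a b.
(* Unrolling the chain, block [c] is a quotient of [S - X] by the power [c + 1] of [w - lambda i];
   the last one, [c = r i - 1], gives the full multiplicity that [blaschke_division] asks for. *)
have chain w i (c : 'I_(r i)) : disk w -> S w - X = (w - lambda i) ^+ c.+1 *: Y2 w i c.
  move=> dw; have [_ /(_ i) e] := key w dw.
  have [j] := ubnP c; elim: j c => // j IH c cj.
  have [c0|c0] := eqVneq (c : nat) 0%N.
    have := e c; rewrite c0 eqxx big1 ?subr0 => [<-|d /eqP //].
    by rewrite expr1.
  have dP : (c.-1 < r i)%N by have := ltn_ord c; lia.
  rewrite (IH (Ordinal dP)) /=; last by lia.
  rewrite prednK ?lt0n // exprSr -scalerA; congr (_ *: _).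
  have := e c; rewrite (negPf c0) (big_pred1 (Ordinal dP)) => [/eqP|d]; last first.
    by rewrite /= -val_eqE /=; lia.
  by rewrite subr_eq0 => /eqP.
have last_lt i : ((r i).-1 < r i)%N by rewrite prednK.
have [h hH fE] : exists2 h, Hinfty h & forall w, disk w -> f w = blaschke lambda r w * h w.
  apply: (@blaschke_division R m lambda r lambda_disk lambda_inj f
    (fun i w => Y2 w i (Ordinal (last_lt i)) a b)).
  - by move=> w dw; exact: (cderivableB (dS w dw) (cderivable_cst _ w)).
  - have [M SM] := contractive_entry_bounded a b cS.
    exists (M + normc (X a b)) => w dw; apply: (le_trans (normcD _ _)).
    by rewrite normcN lerD2r SM.
  - move=> i w dw; have [_ dK _] := SK w dw.
    rewrite (_ : (fun w => _) = fun w => K w (rshift _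
        (tagnat.Rank (p_ := fun i => (\sum_(_ < r i) k)%N) i
          (tagnat.Rank (p_ := fun=> k) (Ordinal (last_lt i)) a))) b) //.
    by apply/funext => y; rewrite !mxE.
  - move=> i w dw; have := congr1 (fun M : 'M[C]_k => M a b) (chain w i (Ordinal (last_lt i)) dw).
    by rewrite /= prednK // !mxE.
exists h => // w dw.
by rewrite -fE // /f addrC subrK.
Qed.

End Interpolation.

Theorem theorem3p1 (R : realType) (k n m : nat)
    (z : 'I_n -> R[i]) (W : 'I_n -> 'M[R[i]]_k)
    (lambda : 'I_m -> R[i]) (r : 'I_m -> nat)
    (hk : (1 <= k)%N) (hn : (1 <= n)%N) (hm : (1 <= m)%N)
    (z_disk : forall i, disk (z i)) (z_neq0 : forall i, z i != 0)
    (z_inj : injective z)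
    (lambda_disk : forall j, disk (lambda j)) (lambda_inj : injective lambda)
    (r_ge1 : forall j, (1 <= r j)%N)
    (z_lambda : forall i j, z i != lambda j) :
  (exists2 S : R[i] -> 'M[R[i]]_k,
     schurB (blaschke lambda r) S & forall i, S (z i) = W i)
  <->
  (exists X : 'M[R[i]]_k, psd (PX z W lambda r X)).
Proof.
split=> [[S SB SW]|[X pX]].
  exact: (interpolant_pick_psd z_disk lambda_disk lambda_inj r_ge1 SB SW).
exact: (pick_psd_interpolant z_disk lambda_disk lambda_inj r_ge1 pX).
Qed.
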